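(* Let $\otimes_\alpha$ be a tensor product (of order $l$) of $0$-symmetric convex bodies and let $P_i\subset\mathbb{E}_i$, $i=1,\ldots,l$, be any tuple of $0$-symmetric convex bodies in Euclidean spaces. (1) If $\otimes_\alpha\subset\otimes_2$ on the class of ellipsoids, then $\text{Löw}(P_1\otimes_\alpha\cdots\otimes_\alpha P_l)=\text{Löw}(P_1)\otimes_2\cdots\otimes_2\text{Löw}(P_l)$. (2) If $\otimes_2\subset\otimes_\alpha$ on the class of ellipsoids, then $\text{John}(P_1\otimes_\alpha\cdots\otimes_\alpha P_l)=\text{John}(P_1)\otimes_2\cdots\otimes_2\text{John}(P_l)$.
   Context: A Euclidean space is a finite dimensional real inner product space; $\mathbb{E}_i,\mathbb{F}_i$ denote Euclidean spaces. $\otimes_{i=1}^l\mathbb{E}_i$ carries the scalar product determined by $\langle x^1\otimes\cdots\otimes x^l,y^1\otimes\cdots\otimes y^l\rangle_H=\prod_i\langle x^i,y^i\rangle_{\mathbb{E}_i}$. A convex body is a compact convex set with nonempty interior; it is $0$-symmetric if $P=-P$. The polar of $C$ is $C^\circ=\{y:\sup_{x\in C}\langle x,y\rangle\le1\}$ (with respect to $\langle\cdot,\cdot\rangle_H$ in tensor product spaces). For convex bodies $P_i\subset\mathbb{E}_i$ with $0$ in the interior, $P_1\otimes_\pi\cdots\otimes_\pi P_l:=\mathrm{conv}\{x^1\otimes\cdots\otimes x^l:x^i\in P_i\}$ and $P_1\otimes_\epsilon\cdots\otimes_\epsilon P_l:=(P_1^\circ\otimes_\pi\cdots\otimes_\pi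 P_l^\circ)^\circ$. A tensor product $\otimes_\alpha$ of order $l$ of $0$-symmetric convex bodies assigns to each $l$-tuple of $0$-symmetric convex bodies $P_i\subset\mathbb{E}_i$ a $0$-symmetric convex body $P_1\otimes_\alpha\cdots\otimes_\alpha P_l\subset\otimes_{i=1}^l\mathbb{E}_i$ such that (1) $P_1\otimes_\pi\cdots\otimes_\pi P_l\subseteq P_1\otimes_\alpha\cdots\otimes_\alpha P_l\subseteq P_1\otimes_\epsilon\cdots\otimes_\epsilon P_l$; (2) for all linear $T_i:\mathbb{E}_i\to\mathbb{F}_i$ and $0$-symmetric convex bodies $Q_i\subset\mathbb{F}_i$ with $T_i(P_i)\subseteq Q_i$, $T_1\otimes\cdots\otimes T_l(P_1\otimes_\alpha\cdots\otimes_\alpha P_l)\subseteq Q_1\otimes_\alpha\cdots\otimes_\alpha Q_l$. An ellipsoid in $\mathbb{E}_i$ is a set $\mathcal{E}_i=T_i(B_{\mathbb{E}_i})$ with $T_i$ a linear bijection of $\mathbb{E}_i$ and $B_{\mathbb{E}_i}$ the closed Euclidean unit ball. The Hilbertian tensor product of ellipsoids is $\mathcal{E}_1\otimes_2\cdots\otimes_2\mathcal{E}_l:=T_1\otimes\cdots\otimes T_l(B_H)$, with $B_H$ the closed unit ball of $(\otimes_i\mathbb{E}_i,\langle\cdot,\cdot\rangle_H)$. ''$\otimes_\alpha\subset\otimes_2$ on the class of ellipsoids'' means $\mathcal{E}_1\otimes_\alpha\cdots\otimes_\alpha\mathcal{E}_l\subseteq\mathcal{E}_1\otimes_2\cdots\otimes_2\mathcal{E}_l$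 for all ellipsoids $\mathcal{E}_i$ (in any Euclidean spaces), and similarly for the reverse inclusion. $\text{Löw}(P)$ is the ellipsoid of minimal volume containing $P$ and $\text{John}(P)$ is the ellipsoid of maximal volume contained in $P$. *)

(* Defs.v *)
From HB Require Import structures.
From mathcomp Require Import all_boot all_order all_algebra.
From mathcomp Require Import all_classical all_reals all_analysis.
From mathcomp Require Import ring lra.

Set Implicit Arguments.
Unset Strict Implicit.
Unset Printing Implicit Defensive.

Import Order.TTheory GRing.Theory Num.Theory.
Import numFieldNormedType.Exports.

Local Open Scope classical_set_scope.
Local Open Scope ring_scope.

(* A Euclidean space is a finite-dimensional real vector space with an inner
   product; the norm and topology are the induced ones. Every vectType with an
   inner product is one, by the factory [Vector_isEuclidean] below. *)
HB.mixin Record NormedModule_isEuclidean (R : realType) E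
    & NormedModule R E & Vector R E := {
  edot : {dot E for (@idfun R)} ;
  edot_norm : forall x : E, edot x x = `|x| ^+ 2
}.

#[short(type="euclideanType")]
HB.structure Definition Euclidean (R : realType) :=
  {E of NormedModule R E & Vector R E & NormedModule_isEuclidean R E}.

HB.factory Record Vector_isEuclidean (R : realType) E & Vector R E := {
  vdot : {dot E for (@idfun R)}
}.

Section RealDot.
Variables (R : realType) (E : lmodType R) (d : {dot E for (@idfun R)}).
Implicit Types x y z : E.

Lemma dotC x y : d x y = d y x.
Proof. by rewrite hermitian_subproof /= expr0 mul1r. Qed.

Lemma dotDl x y z : d (x + y) z = d x z + d y z.
Proof. exact: linearDl. Qed.

Lemma dotZl (a : R) x y : d (a *: x) y = a * d x y.
Proof. by rewrite linearZl_LR. Qed.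

Lemma dotDr x y z : d x (y + z) = d x y + d x z.
Proof. exact: linearDr. Qed.

Lemma dotZr (a : R) x y : d x (a *: y) = a * d x y.
Proof. by rewrite dotC dotZl dotC. Qed.

Lemma dot_ge0 x : 0 <= d x x.
Proof.
have [->|x0] := eqVneq x 0; first by rewrite linear0l.
exact/ltW/neq0_dnorm_gt0.
Qed.

Definition dot_norm x := Num.sqrt (d x x).

Lemma dot_cauchy_schwarz x y : d x y <= dot_norm x * dot_norm y.
Proof.
have [->|y0] := eqVneq y 0.
  by rewrite linear0r mulr_ge0// sqrtr_ge0.
have y1 : 0 < d y y by exact: neq0_dnorm_gt0.
rewrite /dot_norm -sqrtrM ?dot_ge0//; apply: le_trans (ler_norm _) _.
rewrite -sqrtr_sqr ler_wsqrtr//.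
have := dot_ge0 (d y y *: x + (- d x y) *: y).
rewrite dotDl !dotDr !dotZl !dotZr (dotC y x) => h.
have : 0 <= d y y * (d x x * d y y - d x y ^+ 2).
  apply: le_trans h _; rewrite le_eqVlt; apply/orP; left; apply/eqP.
  by ring.
by rewrite pmulr_rge0// subr_ge0.
Qed.

Lemma dot_norm_triangle x y : dot_norm (x + y) <= dot_norm x + dot_norm y.
Proof.
rewrite -(@ler_pXn2r _ 2) ?nnegrE ?addr_ge0 ?sqrtr_ge0//.
rewrite sqrrD /dot_norm !sqr_sqrtr ?dot_ge0//.
rewrite dotDl !dotDr (dotC y x) -!/(dot_norm _).
have := dot_cauchy_schwarz x y; lra.
Qed.

Lemma dot_normZ (a : R) x : dot_norm (a *: x) = `|a| * dot_norm x.
Proof.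
rewrite /dot_norm dotZl dotZr mulrA -expr2 sqrtrM ?sqr_ge0//.
by rewrite sqrtr_sqr.
Qed.

Lemma dot_norm_eq0 x : dot_norm x = 0 -> x = 0.
Proof.
move/eqP; rewrite sqrtr_eq0 => h; apply/eqP/negPn/negP => x0.
by have := neq0_dnorm_gt0 (s := d) x x0; rewrite ltNge h.
Qed.

End RealDot.

HB.builders Context R E & Vector_isEuclidean R E.

HB.instance Definition _ := Lmodule_isNormed.Build R E
  (dot_norm_triangle vdot) (dot_normZ vdot) (@dot_norm_eq0 _ _ vdot).

Let vdot_norm (x : E) : vdot x x = `|x| ^+ 2.
Proof. by rewrite [in RHS]/Num.norm/= sqr_sqrtr ?dot_ge0. Qed.

HB.instance Definition _ := NormedModule_isEuclidean.Build R E vdot_norm.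

HB.end.

Section InnerProduct.
Variables (R : realType) (E : euclideanType R).
Implicit Types x y z : E.

Definition inner x y : R := edot x y.

Lemma innerC x y : inner x y = inner y x.
Proof. by rewrite /inner hermitian_subproof /= expr0 mul1r. Qed.

Lemma innerDl x y z : inner (x + y) z = inner x z + inner y z.
Proof. exact: linearDl. Qed.

Lemma innerZl (a : R) x y : inner (a *: x) y = a * inner x y.
Proof. by rewrite /inner linearZl_LR. Qed.

Lemma inner_suml (I : finType) (a : I -> E) y :
  inner (\sum_i a i) y = \sum_i inner (a i) y.
Proof. exact: linear_sumlz. Qed.

Lemma inner0l y : inner 0 y = 0.
Proof. exact: linear0l. Qed.

Lemma inner_norm x : inner x x = `|x| ^+ 2.
Proof. exact: edot_norm. Qed.

Lemma innerDr x y z : inner x (y + z) = inner x y + inner x z.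
Proof. by rewrite ![inner x _]innerC innerDl. Qed.

Lemma innerZr (a : R) x y : inner x (a *: y) = a * inner x y.
Proof. by rewrite ![inner x _]innerC innerZl. Qed.

Lemma inner_sumr (I : finType) (a : I -> E) x :
  inner x (\sum_i a i) = \sum_i inner x (a i).
Proof. by rewrite innerC inner_suml; apply: eq_bigr => i _; rewrite innerC. Qed.

Lemma exists_orthonormal (n : nat) : (n <= dim E)%N ->
  exists e : 'I_n -> E, forall i j, inner (e i) (e j) = (i == j)%:R.
Proof.
elim: n => [_|n IHn nE]; first by exists (fun=> 0) => -[].
have [e eP] := IHn (ltnW nE).
pose s := [seq e i | i <- enum 'I_n].
have [x xs] : exists x, x \notin span s.
  apply/not_existsP => h.
  have fs : ({:E} <= span s)%VS.
    by apply/subvP => x _; apply/negPn/negP; exact: h.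
  have := leq_trans (dimvS fs) (dim_span s).
  by rewrite dimvf size_map size_enum_ord leqNgt nE.
pose y := x - \sum_i inner x (e i) *: e i.
have ye i : inner y (e i) = 0.
  rewrite /y -scaleN1r innerDl innerZl inner_suml (bigD1 i)//= big1.
    by rewrite innerZl eP eqxx mulr1 addr0 mulN1r subrr.
  by move=> j ji; rewrite innerZl eP (negPf ji) mulr0.
have y0 : y != 0.
  apply: contra xs; rewrite subr_eq0 => /eqP ->.
  apply: rpred_sum => i _; apply: rpredZ; apply: memv_span.
  by apply: map_f; rewrite mem_enum.
pose u := `|y|^-1 *: y.
have ue i : inner u (e i) = 0 by rewrite innerZl ye mulr0.
exists (fun i : 'I_n.+1 => if unlift ord_max i is Some j then e j else u).
move=> i j; case: unliftP => [i' ->|->]; case: unliftP => [j' ->|->].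
- by rewrite eP (inj_eq lift_inj).
- by rewrite innerC ue [lift _ _ == _]eq_sym (negPf (neq_lift _ _)).
- by rewrite ue (negPf (neq_lift _ _)).
- by rewrite eqxx innerZl innerZr inner_norm expr2 mulKf ?mulVf// normr_eq0.
Qed.

Definition onb : 'I_(dim E) -> E := sval (cid (exists_orthonormal (leqnn _))).

Lemma onbP i j : inner (onb i) (onb j) = (i == j)%:R.
Proof. exact: (svalP (cid (exists_orthonormal (leqnn _)))). Qed.

Lemma onb_sum x : x = \sum_i inner x (onb i) *: onb i.
Proof.
pose s := [tuple onb i | i < dim E].
have sE (i : 'I_(dim E)) : s`_i = onb i by rewrite -tnth_nth tnth_mktuple.
have fs : free s.
  apply/freeP => k k0 i.
  have := inner0l (onb i); rewrite -k0 inner_suml (bigD1 i)//= big1.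
    by rewrite sE innerZl onbP eqxx mulr1 addr0.
  by move=> j ji; rewrite sE innerZl onbP (negPf ji) mulr0.
have : x \in span s.
  suff -> : span s = fullv by rewrite memvf.
  apply/eqP; rewrite eqEdim subvf/= dimvf.
  by move: fs; rewrite /free => /eqP ->; rewrite size_tuple.
move=> /coord_span xE; rewrite {1}xE; apply: eq_bigr => i _.
rewrite sE; congr (_ *: _).
rewrite [in RHS]xE inner_suml (bigD1 i)//= big1.
  by rewrite sE innerZl onbP eqxx mulr1 addr0.
by move=> j ji; rewrite sE innerZl onbP (negPf ji) mulr0.
Qed.

Lemma onb_inner x y :
  inner x y = \sum_i inner x (onb i) * inner y (onb i).
Proof.
rewrite {1}(onb_sum x) inner_suml; apply: eq_bigr => i _.
by rewrite innerZl (innerC _ y).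
Qed.

End InnerProduct.

Section TensorSpace.
Variables (R : realType) (l : nat) (E : 'I_l -> euclideanType R).

(* The tensor product of the E_i is modelled by coordinates in the basis
   (e_(k 1) (x) ... (x) e_(k l))_k, where (e_j)_j is the orthonormal basis [onb] of
   E_i. By [inner_otimes] and [tensor_sum] below, this is a space spanned by
   elementary tensors with <(x) x_i, (x) y_i> = \prod_i <x_i, y_i>. *)
Definition tensor_index : finType := {dffun forall i : 'I_l, 'I_(dim (E i))}.

Definition tensor : Type := {ffun tensor_index -> R^o}.

HB.instance Definition _ := Vector.copy tensor {ffun tensor_index -> R^o}.

Definition tensor_dot (z w : tensor) : R := \sum_k z k * w k.

Let tensor_dotC z w : tensor_dot z w = (-1) ^+ false * tensor_dot w z.
Proof.
by rewrite expr0 mul1r; apply: eq_bigr => k _; rewrite mulrC.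
Qed.

Let tensor_dot_bilinear :
  bilinear_for (GRing.Scale.Law.clone _ _ *%R _)
    (GRing.Scale.Law.clone _ _ (idfun \; *%R) _) tensor_dot.
Proof.
split=> [w|w] a x y /=; rewrite /tensor_dot mulr_sumr -big_split/=;
  by apply: eq_bigr => k _; rewrite !ffunE /GRing.scale/=; ring.
Qed.

HB.instance Definition _ :=
  bilinear_isBilinear.Build R tensor tensor R _ _ tensor_dot
    tensor_dot_bilinear.

HB.instance Definition _ :=
  isHermitianSesquilinear.Build R tensor false idfun tensor_dot tensor_dotC.

Let tensor_dot_gt0 (z : tensor) : z != 0 -> 0 < tensor_dot z z.
Proof.
move=> z0; rewrite lt_neqAle sumr_ge0 ?andbT; last first.
  by move=> k _; rewrite -expr2 sqr_ge0.
apply: contra z0; rewrite eq_sym psumr_eq0 => [/allP h|k _]; last first.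
  by rewrite -expr2 sqr_ge0.
apply/eqP/ffunP => k; rewrite ffunE.
by have := h k (mem_index_enum _); rewrite /= mulf_eq0 orbb => /eqP.
Qed.

HB.instance Definition _ :=
  isDotProduct.Build R tensor tensor_dot tensor_dot_gt0.

HB.instance Definition _ := Vector_isEuclidean.Build R tensor tensor_dot.

End TensorSpace.

Section ElementaryTensors.
Variables (R : realType) (l : nat) (E : 'I_l -> euclideanType R).

Definition otimes (x : forall i, E i) : tensor E :=
  [ffun k : tensor_index E => \prod_i inner (x i) (onb (k i))].

Lemma prod_sum_tensor_index (f : forall i, 'I_(dim (E i)) -> R) :
  \prod_i \sum_j f i j = \sum_(k : tensor_index E) \prod_i f i (k i).
Proof.
pose P i : {ffun 'I_(dim (E i)) -> R} := [ffun j => f i j].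
have fE i j : f i j = P i j by rewrite ffunE.
under eq_bigr do under eq_bigr do rewrite fE.
under [RHS]eq_bigr do under eq_bigr do rewrite fE.
under eq_bigr => i _ do
  rewrite (big_tag (fun i (j : 'I_(dim (E i))) => P i j) i).
rewrite bigA_distr_big_dep/=.
rewrite (reindex (@dffun_of_fprod _ (fun i => 'I_(dim (E i)))))/=; last first.
  exact/onW_bij/dffun_of_fprod_bij.
transitivity (\sum_(t : fprod (fun i => 'I_(dim (E i)))) \prod_i P i (t i)).
  by rewrite big_fprod; apply: eq_bigl.
by apply: eq_bigr => t _; apply: eq_bigr => i _; congr (P i _); rewrite ffunE.
Qed.

Lemma inner_otimes (x y : forall i, E i) :
  inner (otimes x) (otimes y) = \prod_i inner (x i) (y i).
Proof.
under [RHS]eq_bigr do rewrite onb_inner.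
rewrite prod_sum_tensor_index; apply: eq_bigr => k _.
by rewrite !ffunE big_split.
Qed.

Lemma otimes_onb (k k' : tensor_index E) :
  otimes (fun i => onb (k i)) k' = (k == k')%:R.
Proof.
rewrite ffunE; under eq_bigr do rewrite onbP.
have [->|kk'] := eqVneq; first by rewrite big1// => i _; rewrite eqxx.
have [i ki] : exists i, k i != k' i.
  apply/existsP; rewrite -negb_forall; apply: contra kk' => /forallP h.
  by apply/eqP/ffunP => i; apply/eqP.
by rewrite (bigD1 i)//= (negPf ki) mul0r.
Qed.

Lemma tensor_sum (z : tensor E) :
  z = \sum_k z k *: otimes (fun i => onb (k i)).
Proof.
apply/ffunP => k'; rewrite sum_ffunE (bigD1 k')//= big1.
  by rewrite ffunE otimes_onb eqxx addr0 /GRing.scale/= mulr1.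
by move=> k kk'; rewrite ffunE otimes_onb (negPf kk') scaler0.
Qed.

End ElementaryTensors.

Section TensorMap.
Variables (R : realType) (l : nat) (E F : 'I_l -> euclideanType R).
Variable T : forall i, 'Hom(E i, F i).

Definition tensor_map_fun (z : tensor E) : tensor F :=
  \sum_k z k *: otimes (fun i => T i (onb (k i))).

Let tensor_map_fun_linear : linear tensor_map_fun.
Proof.
move=> a z w; rewrite /tensor_map_fun scaler_sumr -big_split/=.
by apply: eq_bigr => k _; rewrite !ffunE scalerDl scalerA.
Qed.

HB.instance Definition _ := GRing.isLinear.Build R (tensor E) (tensor F) _
  tensor_map_fun tensor_map_fun_linear.

Definition tensor_map : 'Hom(tensor E, tensor F) := linfun tensor_map_fun.

Lemma tensor_map_otimes (x : forall i, E i) :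
  tensor_map (otimes x) = otimes (fun i => T i (x i)).
Proof.
rewrite lfunE/= /tensor_map_fun; apply/ffunP => k'.
rewrite sum_ffunE [RHS]ffunE.
under [RHS]eq_bigr => i _ do rewrite (onb_sum (x i)) linear_sum/= inner_suml.
rewrite prod_sum_tensor_index; apply: eq_bigr => k _.
rewrite !ffunE /GRing.scale/= -big_split/=.
by apply: eq_bigr => i _; rewrite linearZ/= innerZl.
Qed.

End TensorMap.

Section Volume.
Variable R : realType.

(* n-fold product of the Lebesgue measure of R (Dirac mass for n = 0), where
   R * R^m is identified with R^(m+1). Only the values on Borel sets are
   meaningful. *)
Fixpoint tuple_lebesgue n : set (n.-tuple (measurableTypeR R)) -> \bar R :=
  if n is m.+1 then
    pushforward (lebesgue_measure \x @tuple_lebesgue m)%E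
      (fun p : measurableTypeR R * m.-tuple (measurableTypeR R) => cons_tuple p.1 p.2)
  else \d_(nil_tuple (measurableTypeR R)).

Variable E : euclideanType R.

Definition coords (x : E) : (dim E).-tuple R :=
  [tuple inner x (onb i) | i < dim E].

(* Lebesgue measure transported by an isometry, hence independent of [onb]. *)
Definition volume (A : set E) : \bar R := tuple_lebesgue (coords @` A).

End Volume.

Section ConvexBodies.
Variables (R : realType) (E : euclideanType R).
Implicit Types P C L : set E.

Definition convex_body P := [/\ compact P, convex_set P & P° !=set0].

Definition symmetric_body P := convex_body P /\ P = [set - x | x in P].

Definition polar C : set E :=
  [set y | (ereal_sup [set (inner x y)%:E | x in C] <= 1)%E].

Definition unit_ball : set E := [set x | `|x| <= 1].

Definition ellipsoid L :=
  exists T : 'End(E), bijective T /\ L = T @` unit_ball.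

Definition is_lowner P L := [/\ ellipsoid L, P `<=` L &
  forall M, ellipsoid M -> P `<=` M -> (volume L <= volume M)%E].

Definition is_john P L := [/\ ellipsoid L, L `<=` P &
  forall M, ellipsoid M -> M `<=` P -> (volume M <= volume L)%E].

(* The minimal (resp. maximal) ellipsoid of a symmetric convex body exists and
   is unique, so the default value is irrelevant there. *)
Definition Lowner P : set E := xget set0 (is_lowner P).

Definition John P : set E := xget set0 (is_john P).

End ConvexBodies.

Section TensorProducts.
Variables (R : realType) (l : nat).
Implicit Types E F : 'I_l -> euclideanType R.

Definition proj_tensor E (P : forall i, set (E i)) : set (tensor E) :=
  smallest (@convex_set R (tensor E))
    [set otimes x | x in [set x : forall i, E i | forall i, P i (x i)]].

Definition inj_tensor E (P : forall i, set (E i)) : set (tensor E) :=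
  polar (proj_tensor (fun i => polar (P i))).

(* The set tensor_map T (B_H) does not depend on the T_i with L_i = T_i(B): two
   such maps differ by an orthogonal map on the right. So for ellipsoids this is
   the union of a constant nonempty family. *)
Definition hilbert_tensor E (L : forall i, set (E i)) : set (tensor E) :=
  [set z | exists T : forall i, 'End(E i),
    (forall i, bijective (T i) /\ L i = T i @` @unit_ball R (E i)) /\
    (tensor_map T @` @unit_ball R (tensor E)) z].

Definition tensor_operation :=
  forall E, (forall i, set (E i)) -> set (tensor E).

(* The values of an operation on tuples that are not made of symmetric convex
   bodies are unconstrained, and never used. *)
Record is_tensor_product (alpha : tensor_operation) : Prop := {
  tensor_product_body : forall E (P : forall i, set (E i)),
    (forall i, symmetric_body (P i)) -> symmetric_body (alpha E P) ;
  tensor_product_proj : forall E (P : forall i, set (E i)),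
    (forall i, symmetric_body (P i)) -> proj_tensor P `<=` alpha E P ;
  tensor_product_inj : forall E (P : forall i, set (E i)),
    (forall i, symmetric_body (P i)) -> alpha E P `<=` inj_tensor P ;
  tensor_product_map : forall E F (P : forall i, set (E i))
      (Q : forall i, set (F i)) (T : forall i, 'Hom(E i, F i)),
    (forall i, symmetric_body (P i)) -> (forall i, symmetric_body (Q i)) ->
    (forall i, T i @` P i `<=` Q i) ->
    tensor_map T @` alpha E P `<=` alpha F Q
}.

Definition sub_hilbert_on_ellipsoids (alpha : tensor_operation) :=
  forall E (L : forall i, set (E i)), (forall i, ellipsoid (L i)) ->
    alpha E L `<=` hilbert_tensor L.

Definition hilbert_sub_on_ellipsoids (alpha : tensor_operation) :=
  forall E (L : forall i, set (E i)), (forall i, ellipsoid (L i)) ->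
    hilbert_tensor L `<=` alpha E L.

End TensorProducts.

(* Main.v *)
From HB Require Import structures.
Require Import Defs.
From mathcomp Require Import all_boot all_order all_algebra.
From mathcomp Require Import all_classical all_reals all_analysis.
From mathcomp Require Import measurable_realfun.
From mathcomp Require Import ring lra.

(** An ellipsoid that contains a set [C] has the form [S^-1 B] with
    [|S x| <= 1] on [C], and its volume is inversely proportional to [|det S|];
    so the Loewner ellipsoid of [C] corresponds to a maximiser [S] of [|det|]
    under these constraints ([optimal]). By polarity [T B] lies in a symmetric
    body [P] exactly when [|T^* y| <= 1] on the polar of [P], so the John
    ellipsoid of [P] is governed by the same problem on the polar. Both cases
    are then one statement about determinants.

    The first order condition at a maximiser [S] says that [D = S C] is in John
    position: every quadratic form that is at most 1 on [D] has trace at most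
    the dimension ([optimal_john]). It is obtained by moving from the identity
    towards the form, and it is the dual of the decomposition of the identity
    in John's theorem. Conversely John position implies optimality, with
    uniqueness up to an isometry on the left of [S], by the inequality between
    arithmetic and geometric means applied to the diagonal of a Cholesky factor
    ([det_gram_le1], [john_optimal]).

    John position passes to tensor products ([john_position_tensor]): if a form
    is at most 1 on all [x_1 (x) ... (x) x_l] with [x_i] in [D_i], freeze all
    factors but one, replace that factor by the average over an orthonormal
    basis, and repeat. Hence if the [S_i] are optimal for the [C_i], their
    tensor product beats every linear map that is bounded by 1 on the
    elementary tensors of the [C_i] ([tensor_optimal]).

    For the Loewner ellipsoid take [C_i = P_i]: the product of the [P_i] contains
    these elementary tensors, and it lies in the Hilbertian product of the
    Loewner ellipsoids by monotonicity and the assumption on ellipsoids. For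
    the John ellipsoid take for [C_i] the polar of [P_i]: the product lies in the
    injective product, so the adjoint of a map whose ellipsoid it contains is
    bounded by 1 on the elementary tensors of the polars.

    Volumes are compared through [volume_ellipsoid]: up to an isometry on the
    right a linear map is triangular, and triangular maps rescale an iterated
    Lebesgue measure by Fubini and the one-dimensional substitution. *)

Set Implicit Arguments.
Unset Strict Implicit.
Unset Printing Implicit Defensive.

Import Order.TTheory GRing.Theory Num.Theory.
Import numFieldNormedType.Exports.

Local Open Scope classical_set_scope.
Local Open Scope ring_scope.

(** * Positive definite matrices and determinants *)

Section Matrices.
Variable R : realType.

Definition qform n (A : 'M[R]_n) (u : 'rV[R]_n) : R := (u *m A *m u^T) 0 0.

Definition sqnorm n (u : 'rV[R]_n) : R := (u *m u^T) 0 0.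

Lemma sqnormE n (u : 'rV[R]_n) : sqnorm u = \sum_i u 0 i ^+ 2.
Proof. by rewrite /sqnorm mxE; apply: eq_bigr => i _; rewrite mxE expr2. Qed.

Lemma sqnormZ n a (u : 'rV[R]_n) : sqnorm (a *: u) = a ^+ 2 * sqnorm u.
Proof.
by rewrite !sqnormE mulr_sumr; apply: eq_bigr => i _; rewrite mxE exprMn.
Qed.

Lemma sqnorm_ge0 n (u : 'rV[R]_n) : 0 <= sqnorm u.
Proof. by rewrite sqnormE sumr_ge0// => i _; rewrite sqr_ge0. Qed.

Lemma sqnorm_gt0 n (u : 'rV[R]_n) : u != 0 -> 0 < sqnorm u.
Proof.
move=> u0; rewrite lt_neqAle sqnorm_ge0 andbT; apply: contra u0.
rewrite eq_sym sqnormE psumr_eq0 => [/allP h|i _]; last by rewrite sqr_ge0.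
apply/eqP/rowP => i; rewrite mxE.
by have := h i (mem_index_enum _); rewrite /= sqrf_eq0 => /eqP.
Qed.

Lemma qform_mulmx n m (u : 'rV[R]_n) (K : 'M[R]_(n, m)) :
  qform (K *m K^T) u = sqnorm (u *m K).
Proof. by rewrite /qform /sqnorm trmx_mul !mulmxA. Qed.

Lemma qformE n (A : 'M[R]_n) (u : 'rV[R]_n) :
  qform A u = \sum_i \sum_j A i j * (u 0 i * u 0 j).
Proof.
rewrite /qform mxE; under eq_bigr do rewrite !mxE mulr_suml.
rewrite exchange_big; apply: eq_bigr => i _; apply: eq_bigr => j _ /=; ring.
Qed.

Definition posdef n (A : 'M[R]_n) :=
  A^T = A /\ forall u, u != 0 -> 0 < qform A u.

(** Block elimination. A positive definite matrix with first column [(a, c)] and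
    lower right block [D] has [a > 0], and the Schur complement [D - c c^T / a]
    is again positive definite: its value at [x] is the value of the full form
    at [(w, x)] with [w = - x c / a], the minimiser in the first coordinate. *)
Lemma cholesky n (A : 'M[R]_n) : posdef A ->
  exists M : 'M[R]_n, [/\ is_trig_mx M, (forall i, 0 < M i i) & A = M *m M^T].
Proof.
elim: n A => [|n IHn] A [symA posA].
  by exists 0; split=> [|[]//|]; [rewrite mx0_is_trig|rewrite !flatmx0].
rewrite -[n.+1]/(1 + n)%N in A symA posA *.
pose a := A 0 0; pose c := dlsubmx A; pose D := drsubmx A.
have ulE : ulsubmx A = a%:M.
  rewrite [LHS]mx11_scalar /ulsubmx !mxE/= /a.
  by congr (A _ _)%:M; exact: val_inj.
have urE : ursubmx A = c^T by apply/matrixP => i j; rewrite -{1}symA !mxE.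
have AE : A = block_mx a%:M c^T c D by rewrite -ulE -urE submxK.
have a0 : 0 < a.
  pose e : 'rV[R]_(1 + n) := row_mx 1%:M 0.
  have := posA e; rewrite /qform AE /e mul_row_block !mul0mx !addr0 !mul1mx.
  rewrite tr_row_mx mul_row_col trmx1 trmx0 mulmx0 addr0 mulmx1 mxE mulr1n.
  apply; apply/eqP => /rowP/(_ (lshift n 0)); rewrite row_mxEl !mxE eqxx /=.
  by move/eqP; rewrite oner_eq0.
have ainv : a * a^-1 = 1 by rewrite divff// gt_eqF.
pose B := D - a^-1 *: (c *m c^T).
have posB : posdef B.
  split.
    have symD : D^T = D by apply/matrixP => i j; rewrite /D -{1}symA !mxE.
    by rewrite /B linearB linearZ/= trmx_mul trmxK symD.
  move=> x x0; pose w := - (a^-1 *: (x *m c)).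
  have := posA (row_mx w x).
  rewrite /qform AE mul_row_block tr_row_mx mul_row_col.
  have -> : w *m a%:M + x *m c = 0.
    by rewrite mul_mx_scalar /w scalerN scalerA ainv scale1r addNr.
  rewrite mul0mx add0r /w mulNmx -scalemxAl -mulmxA => h.
  have := h; rewrite /B mulmxA mulmxBr -scalemxAr mulmxA addrC; apply.
  apply: contra x0 => /eqP/(congr1 rsubmx); rewrite row_mxKr => ->.
  by rewrite linear0.
have [N [trigN posN BE]] := IHn B posB.
exists (block_mx (Num.sqrt a)%:M 0 ((Num.sqrt a)^-1 *: c) N).
have s0 : 0 < Num.sqrt a by rewrite sqrtr_gt0.
split.
- by rewrite is_trig_block_mx// eqxx trigN andbT/= scalar_mx_is_trig.
- move=> i; case: (splitP i) => j ij.
    have -> : i = lshift n j by exact: val_inj.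
    by rewrite block_mxEul mxE eqxx mulr1n.
  have -> : i = rshift 1 j by exact: val_inj.
  by rewrite block_mxEdr.
rewrite tr_block_mx mulmx_block trmx0 !mulmx0 !mul0mx !addr0 tr_scalar_mx.
rewrite linearZ/= -scalar_mxM -expr2 sqr_sqrtr ?ltW// mul_scalar_mx.
rewrite scalerA divff ?gt_eqF// scale1r mul_mx_scalar scalerA divff ?gt_eqF//.
rewrite scale1r -scalemxAl -scalemxAr scalerA -invfM -expr2 sqr_sqrtr ?ltW//.
by rewrite -BE /B addrC subrK AE.
Qed.

Lemma posdef_gram n (V : 'M[R]_n) : V \in unitmx -> posdef (V *m V^T).
Proof.
move=> uV; split; first by rewrite trmx_mul trmxK.
move=> u u0; rewrite qform_mulmx sqnorm_gt0//.
by apply: contra u0 => /eqP uV0; rewrite -(mulmxK uV u) uV0 mul0mx.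
Qed.

(** Write [V V^T = M M^T] with [M] triangular. The determinant only sees the
    diagonal of [M], whereas the trace is the sum of the squares of all entries,
    so AM-GM on the squared diagonal gives the bound. In the equality case the
    diagonal is constant and nothing is left for the other entries. Uniqueness
    of extremal ellipsoids rests on this equality case. *)
Lemma det_gram_le1 n (V : 'M[R]_n) : \tr (V *m V^T) <= n%:R ->
  `|\det V| <= 1 /\ (`|\det V| = 1 -> V *m V^T = 1%:M).
Proof.
move=> trV; case: (boolP (V \in unitmx)) => [uV|]; last first.
  rewrite unitmxE unitfE negbK => /eqP ->; rewrite normr0; split=> // /eqP.
  by rewrite eq_sym oner_eq0.
have [M [trigM posM VM]] := cholesky (posdef_gram uV).
have detE : \det V ^+ 2 = \prod_i M i i ^+ 2.
  rewrite prodrXl -(det_trig trigM).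
  by have := congr1 determinant VM; rewrite !det_mulmx !det_tr -!expr2.
have trE : \tr (V *m V^T) =
    \sum_i M i i ^+ 2 + \sum_i \sum_(j | j != i) M i j ^+ 2.
  rewrite VM /mxtrace -big_split/=; apply: eq_bigr => i _; rewrite mxE.
  by rewrite (bigD1 i)//= mxE -expr2; congr (_ + _); apply: eq_bigr => j _;
    rewrite mxE expr2.
have off_ge0 : 0 <= \sum_i \sum_(j | j != i) M i j ^+ 2.
  by apply: sumr_ge0 => i _; apply: sumr_ge0 => j _; rewrite sqr_ge0.
have diag_le : \sum_i M i i ^+ 2 <= n%:R.
  by rewrite (le_trans _ trV)// trE lerDl.
have [n0|n_gt0] := posnP n.
  by subst n; split=> [|_]; rewrite ?det_mx00 ?normr1// flatmx0 [RHS]flatmx0.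
have agm := @Num.Theory.leif_AGM R 'I_n (mem 'I_n) (fun i => M i i ^+ 2)
  (fun i _ => sqr_ge0 _).
rewrite /= cardT size_enum_ord in agm.
have mean_le : (\sum_i M i i ^+ 2) / n%:R <= 1.
  by rewrite ler_pdivrMr ?ltr0n// mul1r.
have mean_ge0 : 0 <= (\sum_i M i i ^+ 2) / n%:R.
  by rewrite divr_ge0// sumr_ge0// => i _; rewrite sqr_ge0.
have meann_le : ((\sum_i M i i ^+ 2) / n%:R) ^+ n <= 1 by exact: exprn_ile1.
split.
  rewrite -(@ler_pXn2r _ 2) ?nnegrE// expr1n (real_normK (num_real _)) detE.
  exact: le_trans agm.1 meann_le.
move=> /(congr1 (fun x => x ^+ 2));
rewrite (real_normK (num_real _)) expr1n detE => det1.
have mean1 : ((\sum_i M i i ^+ 2) / n%:R) = 1.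
  have := agm.1; rewrite det1 => /(conj meann_le)/andP; rewrite -eq_le.
  by rewrite pexpr_eq1// => /eqP.
have sumn : \sum_i M i i ^+ 2 = n%:R.
  have nn0 : n%:R != 0 :> R by rewrite pnatr_eq0 -lt0n.
  by rewrite -[LHS](divfK nn0) mean1 mul1r.
have off0 : \sum_i \sum_(j | j != i) M i j ^+ 2 = 0.
  by apply/eqP; rewrite eq_le off_ge0 andbT; move: trV; rewrite trE sumn gerDl.
have M1 i j : M i j = (i == j)%:R.
  have [<-|ij] := eqVneq i j.
    have := agm.2; rewrite det1 mean1 expr1n eqxx => /esym/forall_inP/= hM.
    have Mi k : M k k ^+ 2 = M i i ^+ 2.
      by have := hM k isT => /forall_inP/(_ i isT)/eqP.
    have : n%:R * M i i ^+ 2 = n%:R * 1.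
      rewrite mulr1 -{2}sumn (eq_bigr (fun=> M i i ^+ 2))//.
      by rewrite sumr_const card_ord mulr_natl.
    move/mulfI; rewrite pnatr_eq0 -lt0n => /(_ n_gt0)/eqP.
    by rewrite sqrf_eq1 => /orP[/eqP//|/eqP Mi1]; have := posM i;
      rewrite Mi1 ltr0N1.
  move/eqP: off0; rewrite psumr_eq0 => [/allP/(_ i (mem_index_enum _))/=|k _].
    rewrite psumr_eq0 => [/allP/(_ j (mem_index_enum _))/=|k _].
      by rewrite eq_sym ij /= sqrf_eq0 => /eqP.
    by rewrite sqr_ge0.
  by apply: sumr_ge0 => k' _; rewrite sqr_ge0.
rewrite VM.
have -> : M = 1%:M by apply/matrixP => i j; rewrite M1 mxE.
by rewrite mul1mx trmx1.
Qed.


(** First order expansion of the determinant at the identity. It is read off the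
    two leading coefficients of the characteristic polynomial of [- X] at [1/t];
    all other coefficients come with a factor [t ^+ 2] at least. *)
Lemma det_perturbation n (X : 'M[R]_n) :
  exists2 C, 0 <= C & forall t, 0 < t -> t <= 1 ->
    1 + t * \tr X - C * t ^+ 2 <= \det (1%:M + t *: X).
Proof.
case: n X => [|n] X.
  exists 0 => // t _ _.
  by rewrite det_mx00 /mxtrace big_ord0 mulr0 addr0 mul0r subr0.
pose p := char_poly (- X).
have sp : size p = n.+2 by exact: size_char_poly.
exists (\sum_(i < n) `|p`_i|); first by rewrite sumr_ge0.
move=> t t0 t1.
have tn0 : t != 0 by rewrite gt_eqF.
have -> : \det (1%:M + t *: X) = t ^+ n.+1 * p.[t^-1].
  rewrite -[p.[_]]/(horner_eval t^-1 p) /p /char_poly -det_map_mx -detZ.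
  congr (\det _); apply/matrixP => i j; rewrite !mxE /= /horner_eval !hornerE.
  have [_|_] := eqVneq i j; rewrite ?mulr1n ?mulr0n !hornerE; last by ring.
  by field.
rewrite horner_coef sp !big_ord_recr/=.
have -> : p`_n.+1 = 1.
  by have := char_poly_monic (- X); rewrite monicE lead_coefE -/p sp => /eqP.
have -> : p`_n = \tr X.
  by have := @char_poly_trace _ n.+1 (- X) isT; rewrite raddfN opprK.
rewrite !mulrDr mul1r -exprMn divff// expr1n.
have -> : t ^+ n.+1 * (\tr X * t^-1 ^+ n) = t * \tr X.
  by rewrite mulrCA exprS -mulrA -exprMn divff// expr1n mulr1 mulrC.
set c := _ * t ^+ 2; set s := t ^+ n.+1 * \sum_(i < n) _.
suff : - c <= s by lra.
rewrite {}/c {}/s mulr_sumr mulr_suml -sumrN ler_sum// => i _.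
rewrite lerNl; apply: le_trans (ler_norm _) _.
rewrite normrN mulrCA normrM ler_wpM2l// exprVn.
rewrite -expfB; last exact: leq_trans (ltn_ord i) (leqnSn n).
rewrite ger0_norm ?exprn_ge0 ?(ltW t0)//; apply: ler_wiXn2l; rewrite ?(ltW t0)//.
by rewrite ltn_subRL addn1 ltnS.
Qed.

Lemma continuous_sum (T : topologicalType) (I : Type) (r : seq I)
    (F : I -> T -> R) :
  (forall i, continuous (F i)) -> continuous (fun x => \sum_(i <- r) F i x).
Proof. by move=> cF; apply: continuous_big => //; exact: add_continuous. Qed.

Lemma continuous_prod (T : topologicalType) (I : Type) (r : seq I)
    (F : I -> T -> R) :
  (forall i, continuous (F i)) -> continuous (fun x => \prod_(i <- r) F i x).
Proof. by move=> cF; apply: continuous_big => //; exact: mul_continuous. Qed.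

Lemma continuous_mul (T : topologicalType) (f g : T -> R) :
  continuous f -> continuous g -> continuous (fun x => f x * g x).
Proof. by move=> cf cg x; apply: cvgM; [exact: cf|exact: cg]. Qed.

Lemma continuous_vec_mx m n i j :
  continuous (fun v : 'rV[R]_(m * n) => vec_mx v i j).
Proof.
have -> : (fun v : 'rV[R]_(m * n) => vec_mx v i j) =
    fun v => v 0 (mxvec_index i j) by apply/funext => v; rewrite mxE.
exact: coord_continuous.
Qed.

Lemma continuous_det_vec n :
  continuous (fun v : 'rV[R]_(n * n) => \det (vec_mx v)).
Proof.
apply: continuous_sum => s; apply: continuous_mul; first exact: cst_continuous.
by apply: continuous_prod => i; exact: continuous_vec_mx.
Qed.

Lemma continuous_norm_det_vec n :
  continuous (fun v : 'rV[R]_(n * n) => `|\det (vec_mx v)|).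
Proof.
by move=> v; exact: (cvg_norm (@continuous_det_vec n v)).
Qed.

Lemma continuous_sqnorm_vec n (u : 'rV[R]_n) :
  continuous (fun v : 'rV[R]_(n * n) => sqnorm (u *m vec_mx v)).
Proof.
have -> : (fun v : 'rV[R]_(n * n) => sqnorm (u *m vec_mx v)) =
    fun v => \sum_j (\sum_i u 0 i * vec_mx v i j) * (\sum_i u 0 i * vec_mx v i j).
  by apply/funext => v; rewrite sqnormE; apply: eq_bigr => j _; rewrite mxE expr2.
have lin j : continuous
    (fun v : 'rV[R]_(n * n) => \sum_i u 0 i * vec_mx v i j).
  apply: continuous_sum => i; apply: continuous_mul; first exact: cst_continuous.
  exact: continuous_vec_mx.
by apply: continuous_sum => j; apply: continuous_mul.
Qed.

(** A ball inside [D] bounds the competitors, whose set is therefore compact; a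
    ball around [D] makes a multiple of the identity a competitor with nonzero
    determinant. *)
Lemma max_det_exists n (D : set 'rV[R]_n) (r r' : R) : 0 < r -> 0 < r' ->
    (forall u, sqnorm u <= r ^+ 2 -> D u) ->
    (forall u, D u -> sqnorm u <= r' ^+ 2) ->
  exists S : 'M[R]_n, [/\ \det S != 0, forall u, D u -> sqnorm (u *m S) <= 1 &
    forall S' : 'M[R]_n, (forall u, D u -> sqnorm (u *m S') <= 1) ->
      `|\det S'| <= `|\det S|].
Proof.
move=> r0 r'0 rD Dr'.
pose K : set 'rV[R]_(n * n) :=
  \bigcap_(u in D) [set v | sqnorm (u *m vec_mx v) <= 1].
have cK : compact K.
  apply: bounded_closed_compact.
    exists r^-1; split; first exact: num_real.
    move=> x rx v Kv /=; rewrite [leLHS]/Num.norm/= mx_normrE.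
    apply: bigmax_le => [|[i0 k] _]; first
      by rewrite (le_trans _ (ltW rx))// invr_ge0 ltW.
    rewrite ord1 /=; case/mxvec_indexP: k => i j.
    apply: le_trans (ltW rx).
    have Di : D (r *: delta_mx 0 i).
      apply: rD; rewrite sqnormE (bigD1 i)//= big1 => [|k ki].
        by rewrite !mxE !eqxx addr0 mulr1.
      by rewrite !mxE (negPf ki) mulr0 expr0n.
    have := Kv _ Di; rewrite /= sqnormE => h.
    have : r ^+ 2 * v 0 (mxvec_index i j) ^+ 2 <= 1.
      apply: le_trans h; rewrite (bigD1 j)//= -scalemxAl -rowE !mxE exprMn lerDl.
      by rewrite sumr_ge0// => k _; rewrite sqr_ge0.
    rewrite -exprMn -real_normK ?num_real// normrM (gtr0_norm r0) => h2.
    rewrite -(ler_pM2l r0) divff ?gt_eqF//.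
    rewrite -(@ler_pXn2r _ 2) ?expr1n ?nnegrE ?mulr_ge0 ?(ltW r0)//.
  apply: closed_bigI => u Du.
  apply: (@closed_comp _ _ (fun v => sqnorm (u *m vec_mx v)) [set x | x <= 1]).
    by move=> v _; exact: continuous_sqnorm_vec.
  exact: closed_le.
have memK S : K (mxvec S) <-> (forall u, D u -> sqnorm (u *m S) <= 1).
  by split=> h u Du; have := h u Du; rewrite /= mxvecK.
have K1 : K (mxvec (r'^-1%:M : 'M[R]_n)).
  apply/memK => u Du; rewrite mul_mx_scalar sqnormZ.
  by rewrite exprVn mulrC ler_pdivrMr ?exprn_gt0// mul1r Dr'.
have [] := @EVT_max_rV R (n * n) (fun v => `|\det (vec_mx v)|) K _ cK.
- by eexists; exact: K1.
- apply: continuous_subspaceT; exact: continuous_norm_det_vec.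
move=> v; rewrite inE => Kv vmax; exists (vec_mx v); split.
- have := vmax _ (mem_set K1); rewrite mxvecK det_scalar.
  rewrite -normr_gt0; apply: lt_le_trans.
  by rewrite normr_gt0 expf_neq0// invr_neq0// gt_eqF.
- by apply: (proj1 (memK _)); rewrite vec_mxK.
- by move=> S' /memK/mem_set/vmax; rewrite mxvecK.
Qed.

Lemma qform_bound n (B : 'M[R]_n) :
  exists2 c, 0 <= c & forall u, `|qform B u| <= c * sqnorm u.
Proof.
exists (\sum_i \sum_j `|B i j|).
  by apply: sumr_ge0 => i _; apply: sumr_ge0.
move=> u; rewrite qformE; apply: le_trans (ler_norm_sum _ _ _) _.
rewrite mulr_suml ler_sum// => i _; apply: le_trans (ler_norm_sum _ _ _) _.
rewrite mulr_suml ler_sum// => j _; rewrite normrM ler_wpM2l//.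
have le1 k : `|u 0 k| ^+ 2 <= sqnorm u.
  rewrite real_normK ?num_real// sqnormE (bigD1 k)//= lerDl.
  by rewrite sumr_ge0// => k' _; rewrite sqr_ge0.
rewrite normrM; have := le1 i; have := le1 j.
have := sqr_ge0 (`|u 0 i| - `|u 0 j|); rewrite sqrrB; lra.
Qed.

Lemma qform_sym n (A : 'M[R]_n) u : qform (2^-1 *: (A + A^T)) u = qform A u.
Proof.
have tA : qform A^T u = qform A u.
  rewrite /qform -[LHS]/((u *m A^T *m u^T) 0 0).
  have -> : u *m A^T *m u^T = (u *m A *m u^T)^T.
    by rewrite !trmx_mul trmxK mulmxA.
  by rewrite mxE.
rewrite /qform -scalemxAr -scalemxAl mulmxDr mulmxDl mxE [X in _ * X]mxE.
by rewrite -![(u *m _ *m _) 0 0]/(qform _ u) tA; field.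
Qed.

(** First order condition at a maximiser. If the trace of [A] exceeded [n], then
    for small [t] the matrix [M = (1 - t) + t A] (with [A] symmetrised) would be
    positive definite of determinant greater than 1, while its form is still at
    most 1 on [D S]; composing [S] with a Cholesky factor of [M] would then give
    a competitor of larger determinant. *)
Lemma max_det_trace n (D : set 'rV[R]_n) (S : 'M[R]_n) : \det S != 0 ->
    (forall u, D u -> sqnorm (u *m S) <= 1) ->
    (forall S' : 'M[R]_n, (forall u, D u -> sqnorm (u *m S') <= 1) ->
      `|\det S'| <= `|\det S|) ->
  forall A : 'M[R]_n, (forall u, D u -> qform A (u *m S) <= 1) ->
  \tr A <= n%:R.
Proof.
move=> S0 fitS maxS A qA; rewrite leNgt; apply/negP => trA.
pose B := 2^-1 *: (A + A^T).
have symB : B^T = B by rewrite /B linearZ/= linearD/= trmxK addrC.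
have trB : \tr B = \tr A by rewrite /B linearZ/= linearD/= mxtrace_tr; field.
have qB u : qform B u = qform A u by exact: qform_sym.
have [c c0 Bc] := qform_bound B.
have [C C0 detC] := det_perturbation (B - 1%:M).
pose d := \tr A - n%:R.
have d0 : 0 < d by rewrite subr_gt0.
(* With t = 1 / q the matrix M is positive definite, since t (1 + c) <= 1/2, and
   the linear term t d of det M dominates the error C t^2, since t C < d. *)
pose q := 2 * (1 + c) + (1 + C) / d.
have Cd : 0 < (1 + C) / d by rewrite divr_gt0//; lra.
have q0 : 0 < q by rewrite /q; lra.
pose t := q^-1.
have t0 : 0 < t by rewrite invr_gt0.
have tq : t * q = 1 by rewrite mulVf// gt_eqF.
have tqE : t * (2 * (1 + c)) + t * ((1 + C) / d) = 1 by rewrite -mulrDr.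
have tc : 2 * (t * (1 + c)) <= 1.
  have : 0 <= t * ((1 + C) / d) by rewrite mulr_ge0// ltW.
  by rewrite mulrCA; lra.
have tC : t * C < d.
  have : t * ((1 + C) / d) <= 1.
    have : 0 <= t * (2 * (1 + c)) by apply: mulr_ge0; lra.
    lra.
  rewrite mulrA ler_pdivrMr// mul1r; apply: lt_le_trans.
  by rewrite ltr_pM2l//; lra.
have t1 : t <= 1 by have := mulr_ge0 (ltW t0) c0; lra.
pose M := 1%:M + t *: (B - 1%:M).
have qM u : qform M u = (1 - t) * sqnorm u + t * qform A u.
  rewrite -qB /qform /M mulmxDr mulmxDl mulmx1 -scalemxAr -scalemxAl mulmxBr.
  rewrite mulmxBl mulmx1 !mxE.
  have -> : \sum_j u 0 j * u^T j 0 = sqnorm u by rewrite /sqnorm mxE.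
  by ring.
have posM : posdef M.
  split; first by rewrite /M linearD/= linearZ/= linearB/= trmx1 symB.
  move=> u u0; rewrite qM -qB.
  have := Bc u; rewrite ler_norml => /andP[+ _].
  have := sqnorm_gt0 u0; set x := sqnorm u; set y := qform _ _ => x0 xy.
  have : t * (- (c * x)) <= t * y by rewrite ler_pM2l.
  have : 0 <= (1 - 2 * (t * (1 + c))) * x.
    by apply: mulr_ge0; [lra|exact: ltW].
  lra.
have [K [_ _ MK]] := cholesky posM.
have : `|\det (S *m K)| <= `|\det S|.
  apply: maxS => u Du; rewrite mulmxA -qform_mulmx -MK qM.
  have := fitS u Du; have := qA u Du; set x := sqnorm _; set y := qform _ _.
  move=> y1 x1.
  have : t * y <= t * 1 by rewrite ler_pM2l.
  have : (1 - t) * x <= (1 - t) * 1 by rewrite ler_wpM2l// subr_ge0.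
  lra.
rewrite det_mulmx normrM ger_pMr ?normr_gt0// => detK.
have detM : \det M <= 1.
  rewrite MK det_mulmx det_tr -expr2 -real_normK ?num_real//.
  by rewrite exprn_ile1.
have := detC t t0 t1; rewrite -/M linearB/= trB mxtrace1 -/d => h.
have : 0 < t * (d - t * C) by rewrite mulr_gt0// subr_gt0.
move: h detM; rewrite expr2; set z := \det M; lra.
Qed.

End Matrices.

(** * Linear maps in orthonormal coordinates *)

Section Coordinates.
Variable R : realType.
Implicit Types E F G : euclideanType R.

Definition crd E (x : E) : 'rV[R]_(dim E) := \row_i inner x (onb i).

Definition vec E (u : 'rV[R]_(dim E)) : E := \sum_i u 0 i *: onb i.

Lemma crdK E : cancel (@crd E) (@vec E).
Proof.
by move=> x; rewrite [RHS]onb_sum; apply: eq_bigr => i _; rewrite mxE.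
Qed.

Lemma vecK E : cancel (@vec E) (@crd E).
Proof.
move=> u; apply/rowP => j; rewrite mxE /vec inner_suml (bigD1 j)//= big1.
  by rewrite innerZl onbP eqxx mulr1 addr0.
by move=> i ij; rewrite innerZl onbP (negPf ij) mulr0.
Qed.

Lemma crd_is_linear E : linear (@crd E).
Proof. by move=> a x y; apply/rowP => i; rewrite !mxE innerDl innerZl. Qed.

Lemma vec_is_linear E : linear (@vec E).
Proof.
move=> a u v; rewrite /vec scaler_sumr -big_split/=; apply: eq_bigr => i _.
by rewrite !mxE scalerDl scalerA.
Qed.

Lemma inner_crd E (x y : E) : inner x y = (crd x *m (crd y)^T) 0 0.
Proof. by rewrite onb_inner mxE; apply: eq_bigr => i _; rewrite !mxE. Qed.

Lemma sqnorm_crd E (x : E) : sqnorm (crd x) = `|x| ^+ 2.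
Proof. by rewrite -inner_norm inner_crd. Qed.

Lemma norm_le_sqnorm E (x : E) (r : R) : 0 <= r ->
  (`|x| <= r) = (sqnorm (crd x) <= r ^+ 2).
Proof. by move=> r0; rewrite sqnorm_crd ler_pXn2r// nnegrE. Qed.

Lemma norm_le1 E (x : E) : (`|x| <= 1) = (sqnorm (crd x) <= 1).
Proof. by rewrite norm_le_sqnorm// expr1n. Qed.

Definition mx_of_hom E F (T : 'Hom(E, F)) : 'M[R]_(dim E, dim F) :=
  \matrix_(i, j) inner (T (onb i)) (onb j).

Lemma crd_lfun E F (T : 'Hom(E, F)) x : crd (T x) = crd x *m mx_of_hom T.
Proof.
apply/rowP => j; rewrite [x in LHS]onb_sum linear_sum !mxE inner_suml.
by apply: eq_bigr => i _; rewrite linearZ !mxE innerZl.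
Qed.

Definition hom_of_mx_fun E F (N : 'M[R]_(dim E, dim F)) (x : E) : F :=
  vec (crd x *m N).

Lemma hom_of_mx_fun_is_linear E F N : linear (@hom_of_mx_fun E F N).
Proof.
move=> a x y; rewrite /hom_of_mx_fun crd_is_linear mulmxDl -scalemxAl.
exact: vec_is_linear.
Qed.

HB.instance Definition _ E F N := GRing.isLinear.Build R E F _
  (@hom_of_mx_fun E F N) (@hom_of_mx_fun_is_linear E F N).

Definition hom_of_mx E F (N : 'M[R]_(dim E, dim F)) : 'Hom(E, F) :=
  linfun (hom_of_mx_fun N).

Lemma crd_hom_of_mx E F (N : 'M[R]_(dim E, dim F)) x :
  crd (hom_of_mx N x) = crd x *m N.
Proof. by rewrite lfunE vecK. Qed.

Lemma crd_onb E i : crd (onb i : E) = delta_mx 0 i.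
Proof. by apply/rowP => j; rewrite !mxE onbP eqxx eq_sym. Qed.

Lemma mx_of_hom_inj E F : injective (@mx_of_hom E F).
Proof.
move=> S T ST; apply/lfunP => x; apply: (can_inj (@crdK F)).
by rewrite !crd_lfun ST.
Qed.

Lemma hom_of_mxK E F : cancel (@hom_of_mx E F) (@mx_of_hom E F).
Proof.
move=> N; apply/row_matrixP => i.
by rewrite !rowE -crd_onb -crd_lfun crd_hom_of_mx.
Qed.

Lemma mx_of_homK E F : cancel (@mx_of_hom E F) (@hom_of_mx E F).
Proof. by move=> T; apply: mx_of_hom_inj; rewrite hom_of_mxK. Qed.

Definition hom_det E (T : 'End(E)) : R := \det (mx_of_hom T).

Definition hom_inv E (T : 'End(E)) : 'End(E) := hom_of_mx (invmx (mx_of_hom T)).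

Definition adjoint E F (T : 'Hom(E, F)) : 'Hom(F, E) :=
  hom_of_mx (mx_of_hom T)^T.

Lemma inner_adjoint E F (T : 'Hom(E, F)) x y :
  inner (T x) y = inner x (adjoint T y).
Proof. by rewrite !inner_crd crd_hom_of_mx crd_lfun trmx_mul trmxK mulmxA. Qed.

Lemma hom_det_adjoint E (T : 'End(E)) : hom_det (adjoint T) = hom_det T.
Proof. by rewrite /hom_det hom_of_mxK det_tr. Qed.

Lemma adjointK E F (T : 'Hom(E, F)) : adjoint (adjoint T) = T.
Proof. by rewrite /adjoint hom_of_mxK trmxK mx_of_homK. Qed.

Lemma hom_invK E (T : 'End(E)) : hom_det T != 0 -> cancel T (hom_inv T).
Proof.
move=> T0 x; apply: (can_inj (@crdK E)).
rewrite crd_hom_of_mx crd_lfun mulmxK//.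
by rewrite unitmxE unitfE.
Qed.

Lemma hom_invKV E (T : 'End(E)) : hom_det T != 0 -> cancel (hom_inv T) T.
Proof.
move=> T0 x; apply: (can_inj (@crdK E)).
rewrite crd_lfun crd_hom_of_mx mulmxKV//.
by rewrite unitmxE unitfE.
Qed.

Lemma hom_det_hom_inv E (T : 'End(E)) : hom_det (hom_inv T) = (hom_det T)^-1.
Proof. by rewrite /hom_det hom_of_mxK det_inv. Qed.

Lemma hom_det_neq0 E (T : 'End(E)) : bijective T <-> hom_det T != 0.
Proof.
split=> [[g gK _]|T0]; last first.
  by exists (hom_inv T); [exact: hom_invK|exact: hom_invKV].
apply/negP => /det0P[u u0 uT].
have crd0 : crd (0 : E) = 0 by apply/rowP => i; rewrite !mxE inner0l.
have : T (vec u) = T 0.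
  by apply: (can_inj (@crdK E)); rewrite !crd_lfun vecK uT crd0 mul0mx.
move=> /(can_inj gK)/(congr1 (@crd E)); rewrite vecK crd0.
exact/eqP.
Qed.

(** ** Quadratic forms and John position *)

Definition quadratic E (g : E -> R) :=
  exists A, forall x, g x = qform A (crd x).

Lemma quadratic_comp E F (L : 'Hom(E, F)) (g : F -> R) :
  quadratic g -> quadratic (g \o L).
Proof.
move=> [A gA]; exists (mx_of_hom L *m A *m (mx_of_hom L)^T) => x.
by rewrite /= gA crd_lfun /qform trmx_mul !mulmxA.
Qed.

Lemma quadratic_sum E (I : Type) (r : seq I) (g : I -> E -> R) :
  (forall i, quadratic (g i)) -> quadratic (fun x => \sum_(i <- r) g i x).
Proof.
move=> qg; elim: r => [|i r [A gA]].
  by exists 0 => x; rewrite big_nil /qform mulmx0 mul0mx mxE.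
have [B gB] := qg i; exists (B + A) => x.
by rewrite big_cons gA gB /qform mulmxDr mulmxDl [RHS]mxE.
Qed.

Lemma quadraticZ E (a : R) (g : E -> R) :
  quadratic g -> quadratic (fun x => a * g x).
Proof.
move=> [A gA]; exists (a *: A) => x.
by rewrite gA /qform -scalemxAr -scalemxAl [RHS]mxE.
Qed.

Lemma trace_quadratic E (A : 'M[R]_(dim E)) (g : E -> R) :
  (forall x, g x = qform A (crd x)) -> \sum_i g (onb i) = \tr A.
Proof.
move=> gA.
apply: eq_bigr => i _.
by rewrite gA /qform crd_onb -rowE trmx_delta -colE !mxE.
Qed.

(** The trace of a quadratic form is the same in all orthonormal bases; only the
    expansion of vectors along [e] is used. This relates the product basis of a
    tensor space to the orthonormal basis [onb] chosen there, which ignores the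
    factors. *)
Lemma quadratic_trace E (K : finType) (e : K -> E) (g : E -> R) :
    (forall z, z = \sum_k inner z (e k) *: e k) -> quadratic g ->
  \sum_k g (e k) = \sum_i g (onb i).
Proof.
move=> eE [A gA].
rewrite (trace_quadratic gA); under eq_bigr do rewrite gA qformE.
rewrite exchange_big; apply: eq_bigr => i _ /=.
rewrite exchange_big (bigD1 i)//= [X in _ + X]big1 => [|j ji].
  rewrite -mulr_sumr addr0 -[RHS]mulr1; congr (_ * _).
  transitivity (inner (onb i) (onb i : E)); last by rewrite onbP eqxx.
  rewrite {1}[onb i]eE inner_suml; apply: eq_bigr => k _.
  by rewrite innerZl !mxE innerC.
rewrite -mulr_sumr; apply/eqP; rewrite mulf_eq0; apply/orP; right; apply/eqP.
transitivity (inner (onb i) (onb j : E)); last by rewrite onbP eq_sym (negPf ji).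
rewrite {1}[onb i]eE inner_suml; apply: eq_bigr => k _.
by rewrite innerZl !mxE innerC.
Qed.

(** Dual form of the decomposition of the identity in John's theorem: by
    separation it says that [Id / n] lies in the closed convex hull of 0 and of
    the rank one operators [x (x) x] with [x] in [D]. In this form it passes to
    tensor products without any separation argument. *)
Definition john_position E (D : set E) := forall g, quadratic g ->
  (forall x, D x -> g x <= 1) -> \sum_i g (onb i : E) <= (dim E)%:R.

(** The ellipsoid [S^-1 B] has least volume among those that contain [C]. *)
Definition optimal E (C : set E) (S : 'End(E)) := [/\ hom_det S != 0,
  forall x, C x -> `|S x| <= 1 &
  forall S' : 'End(E), (forall x, C x -> `|S' x| <= 1) ->
    `|hom_det S'| <= `|hom_det S|].

Lemma fits_rows E (C : set E) (S : 'M[R]_(dim E)) :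
  (forall u, [set crd x | x in C] u -> sqnorm (u *m S) <= 1) <->
  (forall x, C x -> `|hom_of_mx S x| <= 1).
Proof.
split=> [h x Cx|h _ [x Cx <-]]; first
  by rewrite norm_le1 crd_hom_of_mx h//; exists x.
by rewrite -crd_hom_of_mx -norm_le1 h.
Qed.

Lemma optimal_exists E (C : set E) (r r' : R) : 0 < r -> 0 < r' ->
    (forall x, `|x| <= r -> C x) -> (forall x, C x -> `|x| <= r') ->
  exists S, optimal C S.
Proof.
move=> r0 r'0 rC Cr'.
have [||S [S0 /fits_rows fS mS]] :=
    @max_det_exists R (dim E) [set crd x | x in C] r r' r0 r'0.
- move=> u ur; exists (vec u); rewrite ?vecK//; apply: rC.
  by rewrite norm_le_sqnorm ?vecK// ltW.
- by move=> _ [x /Cr' xr <-]; rewrite -norm_le_sqnorm// ltW.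
exists (hom_of_mx S); split=> //; first by rewrite /hom_det hom_of_mxK.
move=> S' fS'; rewrite /hom_det hom_of_mxK; apply: mS; apply/fits_rows.
by rewrite mx_of_homK.
Qed.

Lemma optimal_john E (C : set E) S : optimal C S -> john_position (S @` C).
Proof.
move=> [S0 fS mS] g [A gA] g1.
rewrite (trace_quadratic gA).
apply: (@max_det_trace R _ [set crd x | x in C] (mx_of_hom S)) => //.
- by apply/fits_rows; rewrite mx_of_homK.
- move=> S' /fits_rows fS'; have := mS _ fS'.
  by rewrite /hom_det hom_of_mxK.
- by move=> _ [x Cx <-]; rewrite -crd_lfun -gA g1//; exists x.
Qed.

(** With [V = S' S^-1], the form [|V x|^2] is at most 1 on [S C], so its trace
    is at most the dimension and [det_gram_le1] bounds [det V]; in the equality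
    case [V] is an isometry. *)
Lemma john_optimal E (C : set E) (S S' : 'End(E)) : hom_det S != 0 ->
    john_position (S @` C) -> (forall x, C x -> `|S' x| <= 1) ->
  `|hom_det S'| <= `|hom_det S| /\
  (`|hom_det S'| = `|hom_det S| -> forall x, `|S' x| = `|S x|).
Proof.
move=> S0 jS fS'.
have uS : mx_of_hom S \in unitmx by rewrite unitmxE unitfE.
pose V := invmx (mx_of_hom S) *m mx_of_hom S'.
have SV : mx_of_hom S' = mx_of_hom S *m V by rewrite mulKVmx.
have trV : \tr (V *m V^T) <= (dim E)%:R.
  have -> : \tr (V *m V^T) = \sum_i sqnorm (crd (onb i : E) *m V).
    apply: eq_bigr => i _; rewrite sqnormE crd_onb -rowE mxE.
    by apply: eq_bigr => j _; rewrite !mxE expr2.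
  apply: (jS (fun x => sqnorm (crd x *m V))).
    by exists (V *m V^T) => x; rewrite qform_mulmx.
  move=> _ [x Cx <-]; rewrite crd_lfun -mulmxA -SV -crd_lfun -norm_le1.
  exact: fS'.
have [V1 V1E] := det_gram_le1 trV.
have detS' : `|hom_det S'| = `|hom_det S| * `|\det V|.
  by rewrite /hom_det SV det_mulmx normrM.
split; first by rewrite detS' ger_pMr ?normr_gt0.
rewrite detS' -{2}[`|hom_det S|]mulr1 => /mulfI; rewrite normr_eq0 => /(_ S0).
move=> /V1E VV x; apply/eqP.
rewrite -(@eqrXn2 _ 2)// -!sqnorm_crd !crd_lfun SV mulmxA -qform_mulmx VV.
by rewrite /qform mulmx1.
Qed.

End Coordinates.

(** * Tensor products of sets in John position *)

Local Notation upd := eqtype.dfwith.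

Lemma upd_swap (I : eqType) (T : I -> Type) (f : forall k, T k) i j
    (x : T i) (y : T j) : i != j -> upd (upd f x) y = upd (upd f y) x.
Proof.
move=> ij; apply/functional_extensionality_dep => k.
have [ik|ik] := eqVneq i k.
  by subst k; rewrite [LHS]dfwith_out ?dfwith_in// eq_sym.
have [jk|jk] := eqVneq j k; first by subst k; rewrite [RHS]dfwith_out ?dfwith_in.
by rewrite !dfwith_out.
Qed.

Section TensorPosition.
Variables (R : realType) (l : nat) (E : 'I_l -> euclideanType R).

Definition slot_fun (x : forall i, E i) i (y : E i) : tensor E :=
  otimes (upd x y).

Lemma slot_fun_is_linear x i : linear (slot_fun x (i := i)).
Proof.
move=> a y z; apply/ffunP => k; rewrite !ffunE /GRing.scale/=.
have slotE w : \prod_j inner (upd x w j) (onb (k j)) =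
    inner w (onb (k i)) * \prod_(j | j != i) inner (x j) (onb (k j)).
  rewrite (bigD1 i)//= dfwith_in; congr (_ * _).
  by apply: eq_bigr => j ji; rewrite dfwith_out// eq_sym.
by rewrite !slotE innerDl innerZl; ring.
Qed.

HB.instance Definition _ x i := GRing.isLinear.Build R (E i) (tensor E) _
  (slot_fun x (i := i)) (slot_fun_is_linear x (i := i)).

Definition slot x i : 'Hom(E i, tensor E) := linfun (slot_fun x (i := i)).

Lemma slotE x i y : slot x i y = otimes (upd x y).
Proof. by rewrite lfunE. Qed.

Definition onb_tuple (k : tensor_index E) i : E i := onb (k i).

Lemma tensor_basis (z : tensor E) :
  z = \sum_k inner z (otimes (onb_tuple k)) *: otimes (onb_tuple k).
Proof.
rewrite {1}[z]tensor_sum; apply: eq_bigr => k _; congr (_ *: _).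
rewrite -[RHS]/(\sum_k' z k' * otimes (onb_tuple k) k') (bigD1 k)//= big1.
  by rewrite otimes_onb eqxx mulr1 addr0.
by move=> k' k'k; rewrite otimes_onb eq_sym (negPf k'k) mulr0.
Qed.

Lemma dim_tensor : dim (tensor E) = #|tensor_index E|.
Proof.
apply/eqP; rewrite -(eqr_nat R); apply/eqP.
have qn : quadratic (fun z : tensor E => `|z| ^+ 2).
  by exists 1%:M => z; rewrite -sqnorm_crd /qform mulmx1.
have := quadratic_trace tensor_basis qn.
have normk k : `|otimes (onb_tuple k)| ^+ 2 = 1 :> R.
  by rewrite -inner_norm inner_otimes big1// => i _; rewrite onbP eqxx.
under eq_bigr => k _ do rewrite normk.
under [RHS]eq_bigr => k _ do rewrite -inner_norm onbP eqxx.
by rewrite !sumr_const card_ord.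
Qed.

Implicit Types f : (forall i, E i) -> R.

(** Normalised partial trace in the [i]-th factor. The result is a function
    that does not depend on the [i]-th component of its argument. *)
Definition average i f : (forall i, E i) -> R := fun x =>
  (dim (E i))%:R^-1 * \sum_a f (upd x (onb a : E i)).

Definition total f := \sum_(k : tensor_index E) f (onb_tuple k).

(** The map that exchanges [a] with the [i]-th index of [k] is an involution on
    the pairs [(k, a)], so replacing an index by all possible values counts every
    basis tensor [dim (E i)] times. *)
Lemma total_average i f : (0 < dim (E i))%N -> total (average i f) = total f.
Proof.
move=> Ei0; rewrite /total /average -mulr_sumr.
pose set_at (p : tensor_index E * 'I_(dim (E i))) : tensor_index E :=
  [ffun j => upd (fun j => p.1 j) p.2 j].
have set_atE k a : upd (onb_tuple k) (onb a : E i) = onb_tuple (set_at (k, a)).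
  apply/functional_extensionality_dep => j; rewrite /onb_tuple ffunE/=.
  have [ij|ij] := eqVneq i j; first by subst j; rewrite !dfwith_in.
  by rewrite !dfwith_out.
under eq_bigr => k _ do under eq_bigr => a _ do rewrite set_atE.
rewrite pair_big/=.
pose h p := (set_at p, p.1 i).
have hK : involutive h.
  move=> [k a]; congr pair; last by rewrite ffunE/= dfwith_in.
  apply/ffunP => j; rewrite ffunE/=.
  have [ij|ij] := eqVneq i j; first by subst j; rewrite dfwith_in.
  by rewrite dfwith_out// ffunE/= dfwith_out.
rewrite (reindex_inj (inv_inj hK))/=.
have -> : \sum_(p | true && true) f (onb_tuple (set_at ((h p).1, (h p).2))) =
    \sum_(k : tensor_index E) \sum_(a < dim (E i)) f (onb_tuple k).
  by rewrite pair_big/=; apply: eq_bigr => p _; have := hK p => /(congr1 fst)/= ->.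
have sumE k : \sum_(a < dim (E i)) f (onb_tuple k) =
    (dim (E i))%:R * f (onb_tuple k) by rewrite sumr_const card_ord mulr_natl.
rewrite (eq_bigr (fun k => (dim (E i))%:R * f (onb_tuple k))) => [|k _].
  by rewrite -mulr_sumr mulKf// pnatr_eq0 -lt0n.
exact: sumE.
Qed.

Variable D : forall i, set (E i).
Arguments D : clear implicits.
Hypothesis john_D : forall i, john_position (D i).

(** Invariant after averaging over the factors in [s]: the upper bound 1 no
    longer requires anything of the components in [s], and the function is still
    quadratic in each of the others. *)
Definition averaged (s : seq 'I_l) f :=
  (forall i x, i \notin s -> quadratic (fun y : E i => f (upd x y))) /\
  (forall x, (forall i, i \notin s -> D i (x i)) -> f x <= 1).

Lemma averaged_cons i s f : (0 < dim (E i))%N -> i \notin s ->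
  averaged s f -> averaged (i :: s) (average i f).
Proof.
move=> Ei0 si [qf f1]; split=> [j x|x Dx].
  rewrite inE negb_or => /andP[ji sj]; apply: quadraticZ.
  apply: quadratic_sum => a.
  have -> : (fun y : E j => f (upd (upd x y) (onb a : E i))) =
      fun y => f (upd (upd x (onb a : E i)) y).
    by apply/funext => y; rewrite upd_swap.
  exact: qf.
rewrite /average mulrC ler_pdivrMr ?ltr0n// mul1r.
apply: (john_D (qf i x si)) => y Dy; apply: f1 => j sj.
have [ij|ij] := eqVneq i j; first by subst j; rewrite dfwith_in.
by rewrite dfwith_out//; apply: Dx; rewrite inE negb_or sj eq_sym ij.
Qed.

Lemma averaged_exists s f : (forall i, (0 < dim (E i))%N) -> uniq s ->
  averaged [::] f -> exists2 g, averaged s g & total g = total f.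
Proof.
move=> E0; elim: s => [|i s IHs] /=; first by exists f.
move=> /andP[si us] /(IHs us)[g sg <-]; exists (average i g).
  exact: averaged_cons.
exact: total_average.
Qed.

(** Averaging one factor at a time uses the John position of that factor with
    the other components frozen, and it preserves the sum over the product
    basis. Once all factors are averaged the bound 1 holds everywhere, so the sum
    is at most the number of basis tensors. *)
Lemma john_position_tensor :
  john_position [set otimes x | x in [set x | forall i, D i (x i)]].
Proof.
move=> g qg g1; rewrite -(quadratic_trace tensor_basis qg) dim_tensor.
(* The normalisation in [average] needs positive dimensions; with a
   zero-dimensional factor the product basis is empty. *)
have [i /eqP Ei0|E0] := pickP (fun i => dim (E i) == 0%N).
  rewrite big1 ?ler0n// => k _.
  by have := ltn_ord (k i); rewrite [X in (_ < X)%N]Ei0.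
have dE0 i : (0 < dim (E i))%N by rewrite lt0n E0.
have av0 : averaged [::] (fun x => g (otimes x)).
  split=> [i x _|x Dx]; last by apply: g1; exists x => // i; exact: Dx.
  have -> : (fun y : E i => g (otimes (upd x y))) = g \o slot x i.
    by apply/funext => y; rewrite /= slotE.
  exact: quadratic_comp.
have [f [_ f1] totf] := averaged_exists dE0 (enum_uniq 'I_l) av0.
rewrite -[leLHS]/(total (fun x => g (otimes x))) -totf -sumr_const ler_sum//.
by move=> k _; apply: f1 => i; rewrite mem_enum.
Qed.

End TensorPosition.

Section TensorMaps.
Variables (R : realType) (l : nat).
Implicit Types E F G : 'I_l -> euclideanType R.

Lemma tensor_hom_ext E (V : euclideanType R) (S T : 'Hom(tensor E, V)) :
  (forall x, S (otimes x) = T (otimes x)) -> S = T.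
Proof.
move=> ST; apply/lfunP => z; rewrite [z]tensor_basis !linear_sum.
by apply: eq_bigr => k _; rewrite !linearZ /= ST.
Qed.

Lemma tensor_map_comp E F G (S : forall i, 'Hom(F i, G i))
    (T : forall i, 'Hom(E i, F i)) z :
  tensor_map S (tensor_map T z) = tensor_map (fun i => (S i \o T i)%VF) z.
Proof.
rewrite -comp_lfunE; congr (fun_of_lfun _ z); apply: tensor_hom_ext => x.
rewrite comp_lfunE !tensor_map_otimes; congr (otimes _).
by apply/functional_extensionality_dep => i; rewrite comp_lfunE.
Qed.

Lemma tensor_map_id E z : tensor_map (fun i => \1%VF : 'End(E i)) z = z.
Proof.
rewrite -[RHS]id_lfunE; congr (fun_of_lfun _ z); apply: tensor_hom_ext => x.
rewrite id_lfunE tensor_map_otimes; congr (otimes _).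
by apply/functional_extensionality_dep => i; rewrite id_lfunE.
Qed.

Lemma tensor_mapK E F (S : forall i, 'Hom(F i, E i))
    (T : forall i, 'Hom(E i, F i)) :
  (forall i, cancel (T i) (S i)) -> cancel (tensor_map T) (tensor_map S).
Proof.
move=> TK z; rewrite tensor_map_comp -[RHS]tensor_map_id.
congr (tensor_map _ z); apply/functional_extensionality_dep => i.
by apply/lfunP => x; rewrite comp_lfunE id_lfunE TK.
Qed.

Lemma adjoint_tensor_map E F (T : forall i, 'Hom(E i, F i)) :
  adjoint (tensor_map T) = tensor_map (fun i => adjoint (T i)).
Proof.
apply: tensor_hom_ext => y; rewrite tensor_map_otimes.
rewrite [LHS]tensor_basis [RHS]tensor_basis; apply: eq_bigr => k _.
congr (_ *: _); rewrite [LHS]innerC -inner_adjoint tensor_map_otimes.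
rewrite !inner_otimes; apply: eq_bigr => i _.
by rewrite inner_adjoint innerC.
Qed.

(** The competitors [S'] are constrained on elementary tensors only. The
    conclusion therefore applies to every set that contains those tensors, and
    the equality case identifies the extremal ellipsoid of such a set. *)
Lemma tensor_optimal E (C : forall i, set (E i)) (S : forall i, 'End(E i)) :
    (forall i, optimal (C i) (S i)) ->
  hom_det (tensor_map S) != 0 /\ forall S' : 'End(tensor E),
    (forall x, (forall i, C i (x i)) -> `|S' (otimes x)| <= 1) ->
    `|hom_det S'| <= `|hom_det (tensor_map S)| /\
    (`|hom_det S'| = `|hom_det (tensor_map S)| ->
      forall z, `|S' z| = `|tensor_map S z|).
Proof.
move=> optS.
have S0 i : hom_det (S i) != 0 by case: (optS i).
have dS : hom_det (tensor_map S) != 0.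
  apply/hom_det_neq0; exists (tensor_map (fun i => hom_inv (S i))).
    by apply: tensor_mapK => i; exact: hom_invK.
  by apply: tensor_mapK => i; exact: hom_invKV.
split=> // S' fS'.
pose W := [set otimes x | x in [set x | forall i, C i (x i)]].
apply: (@john_optimal R (tensor E) W) => //; last by move=> _ [x Cx <-]; exact: fS'.
have := john_position_tensor (fun i => optimal_john (optS i)).
move=> jS g qg g1; apply: jS => // _ [x Dx <-]; apply: g1.
pose y i := s2val (cid2 (Dx i)).
exists (otimes y).
  by exists y => // i; exact: s2valP (cid2 (Dx i)).
rewrite tensor_map_otimes; congr (otimes _).
by apply/functional_extensionality_dep => i; exact: s2valP' (cid2 (Dx i)).
Qed.

End TensorMaps.

(** * Volume of ellipsoids *)

Section TupleLebesgue.
Variable R : realType.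
Local Notation T := (measurableTypeR R).
Local Notation leb := (@lebesgue_measure R).
Implicit Types (u w x : R).

Lemma measurable_affine u w :
  measurable_fun [set: T] (fun x : T => x * u + w : T).
Proof. by apply: measurable_funD => //; apply: measurable_funM. Qed.

(** By uniqueness of Lebesgue measure it suffices to compare on intervals, whose
    preimages are intervals again, reversed when [u < 0]. *)
Lemma lebesgue_affine u w (A : set T) : u != 0 -> measurable A ->
  leb ((fun x : T => x * u + w : T) @^-1` A) = (`|u|^-1%:E * leb A)%E.
Proof.
move=> u0 mA; pose f := fun x : T => x * u + w : T.
have mf : measurable_fun [set: T] f by exact: measurable_affine.
pose mu : {measure set T -> \bar R} :=
  mscale (NngNum (normr_ge0 u)) (measure_function_pushforward__canonical__measure_function_Measure leb mf).
have -> : leb A = mu A.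
  apply: lebesgue_measure_unique => // _ [[a b] _ <-] /=.
  rewrite /mscale /= /pushforward lebesgue_measure_itv/= lte_fin.
  have [u_gt0|u_lt0|/eqP] := ltgtP 0 u; last by rewrite eq_sym (negPf u0).
    have -> : f @^-1` `]a, b] = `]((a - w) / u), ((b - w) / u)]%classic.
      apply/seteqP; split=> x /=; rewrite !in_itv/= ltr_pdivrMr// ler_pdivlMr//;
        by rewrite /f ltrBlDr lerBrDr.
    rewrite lebesgue_measure_itv/= lte_fin ltr_pM2r ?invr_gt0// ltrD2r.
    case: ifP => _; last by rewrite mule0.
    by rewrite -!EFinD -EFinM gtr0_norm//; congr EFin; field.
  have -> : f @^-1` `]a, b] = `[((b - w) / u), ((a - w) / u)[%classic.
    apply/seteqP; split=> x /=; rewrite !in_itv/= ltr_ndivlMr// ler_ndivrMr//;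
      by rewrite /f ltrBlDr lerBrDr andbC.
  rewrite lebesgue_measure_itv/= lte_fin ltr_nM2r ?invr_lt0// ltrD2r.
  case: ifP => _; last by rewrite mule0.
  by rewrite -!EFinD -EFinM ltr0_norm//; congr EFin; field.
rewrite /mu /= /mscale /= /pushforward muleA -EFinM mulVf ?normr_eq0//.
by rewrite mul1e.
Qed.

Lemma ge0_integral_affine u w (h : T -> \bar R) : u != 0 ->
    measurable_fun setT h -> (forall x, 0 <= h x)%E ->
  (\int[leb]_x h (x * u + w)%R = `|u|^-1%:E * \int[leb]_x h x)%E.
Proof.
move=> u0 mh h0; pose f := fun x : T => x * u + w : T.
have mf : measurable_fun [set: T] f by exact: measurable_affine.
have ui : 0 <= `|u|^-1 by rewrite invr_ge0.
rewrite -[LHS]/(\int[leb]_(x in f @^-1` setT) (h \o f) x)%E.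
rewrite -ge0_integral_pushforward//.
rewrite (eq_measure_integral (mscale (NngNum ui) leb)).
  by rewrite ge0_integral_mscale.
by move=> A mA _; rewrite /= /mscale/= -(lebesgue_affine w u0 mA).
Qed.

Lemma measurable_cons_tuple n :
  measurable_fun [set: T * n.-tuple T]
    (fun p : T * n.-tuple T => cons_tuple p.1 p.2).
Proof. exact: (measurable_cons measurable_fst measurable_snd). Qed.

Lemma measurable_uncons n : measurable_fun [set: n.+1.-tuple T]
  (fun t : n.+1.-tuple T => (thead t, [tuple of behead t]) : T * n.-tuple T).
Proof.
apply/measurable_fun_pairP; split; first exact: measurable_tnth.
exact: measurable_behead.
Qed.

(** [tuple_lebesgue] is a bare set function; identifying it with a sigma-finite
    measure gives monotonicity and the measurability of sections. *)
Lemma tuple_lebesgue_sigma_finite n :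
  exists mu : {sigma_finite_measure set (n.-tuple T) -> \bar R},
    @tuple_lebesgue R n = mu.
Proof.
elim: n => [|m [mu muE]] /=; first by exists \d_(nil_tuple T).
pose nu : {measure set (m.+1.-tuple T) -> \bar R} :=
  measure_function_pushforward__canonical__measure_function_Measure
    (leb \x mu)%E (@measurable_cons_tuple m).
have nu_sf : sigma_finite setT nu.
  have /sigma_finiteP[F [FT ndF Foo]] := sigma_finiteT leb.
  have /sigma_finiteP[G [GT ndG Goo]] := sigma_finiteT mu.
  pose d (t : m.+1.-tuple T) : T * m.-tuple T := (thead t, [tuple of behead t]).
  exists (fun i => d @^-1` (F i `*` G i)).
    apply/seteqP; split=> // t _.
    have : setT (thead t) by []. rewrite {1}FT => -[i _ Fi].
    have : setT [tuple of behead t] by []. rewrite {1}GT => -[j _ Gj].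
    exists (maxn i j) => //; split=> /=.
      by move: (thead t) Fi; exact/subsetPset/ndF/leq_maxl.
    by move: [tuple of behead t] Gj; exact/subsetPset/ndG/leq_maxr.
  move=> i; have [mF Fi_oo] := Foo i; have [mG Gi_oo] := Goo i; split.
    rewrite -[X in measurable X]setTI; apply: measurable_uncons => //.
    exact: measurableX.
  rewrite /nu /= /pushforward.
  have -> : (fun p : T * m.-tuple T => cons_tuple p.1 p.2) @^-1`
      (d @^-1` (F i `*` G i)) = F i `*` G i.
    apply/funext => -[x t] /=; congr (F i _ /\ G i _); exact: val_inj.
  by rewrite product_measure1E// lte_mul_pinfty// ge0_fin_numE.
pose nu' : {sigma_finite_measure set (m.+1.-tuple T) -> \bar R} :=
  HB.pack (Measure.sort nu) (Measure_isSigmaFinite.Build _ _ _ _ nu_sf).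
by exists nu'; rewrite muE.
Qed.

Lemma tuple_lebesgueS m (A : set (m.+1.-tuple T)) :
  tuple_lebesgue A =
  (\int[leb]_x @tuple_lebesgue R m ((fun t => cons_tuple x t) @^-1` A))%E.
Proof.
rewrite /= /pushforward /product_measure1; apply: eq_integral => x _ /=.
congr (tuple_lebesgue _); apply/funext => t.
by rewrite /xsection /= in_setE.
Qed.

Lemma measurable_cons_section m x (A : set (m.+1.-tuple T)) : measurable A ->
  measurable ((fun t : m.-tuple T => cons_tuple (x : T) t) @^-1` A).
Proof.
move=> mA; rewrite -[X in measurable X]setTI.
have mc : measurable_fun [set: m.-tuple T] (fun t => cons_tuple (x : T) t).
  exact: (measurable_cons (f := fun=> x : T) (g := id)).
exact: mc.
Qed.

Lemma measurable_tuple_section m (A : set (m.+1.-tuple T)) : measurable A ->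
  measurable_fun [set: T]
    (fun x : T => @tuple_lebesgue R m ((fun t => cons_tuple x t) @^-1` A)).
Proof.
move=> mA; have [mu muE] := tuple_lebesgue_sigma_finite m.
have mcA : measurable
    ((fun p : T * m.-tuple T => cons_tuple p.1 p.2) @^-1` A).
  by rewrite -[X in measurable X]setTI; exact: measurable_cons_tuple.
have := measurable_fun_xsection mu mcA; rewrite -muE.
congr (measurable_fun _ _); apply/funext => x /=.
congr (tuple_lebesgue _); apply/funext => t.
by rewrite /xsection /= in_setE.
Qed.

Lemma tuple_lebesgue_ge0 n (A : set (n.-tuple T)) :
  (0 <= @tuple_lebesgue R n A)%E.
Proof. by have [mu ->] := tuple_lebesgue_sigma_finite n. Qed.

Definition row_of_tuple n (t : n.-tuple T) : 'rV[R]_n := \row_i tnth t i.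

Definition tuple_of_row n (u : 'rV[R]_n) : n.-tuple T := [tuple u 0 i | i < n].

Lemma row_of_tupleK n : cancel (@row_of_tuple n) (@tuple_of_row n).
Proof. by move=> t; apply: eq_from_tnth => i; rewrite tnth_mktuple mxE. Qed.

Lemma tuple_of_rowK n : cancel (@tuple_of_row n) (@row_of_tuple n).
Proof. by move=> u; apply/rowP => i; rewrite mxE tnth_mktuple. Qed.

Lemma row_of_cons_tuple n x (t : n.-tuple T) :
  row_of_tuple (cons_tuple (x : T) t) = row_mx (x%:M : 'M[R]_1) (row_of_tuple t).
Proof.
apply/rowP => i; rewrite mxE; case: (unliftP ord0 i) => [j ->|->].
  have e : row_mx (x%:M : 'M[R]_1) (row_of_tuple t) 0 (rshift 1 j) = tnth t j.
    by rewrite row_mxEr mxE.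
  by rewrite tnthS -e; congr (row_mx _ _ _ _); exact: val_inj.
have e : row_mx (x%:M : 'M[R]_1) (row_of_tuple t) 0 (lshift n 0) = x.
  by rewrite row_mxEl mxE eqxx.
rewrite -[LHS]/(x : R) -[LHS]e.
by congr (row_mx _ _ _ _); exact: val_inj.
Qed.

Lemma row_mx_to_tuple n (p : 'rV[R]_1) (q : 'rV[R]_n) :
  tuple_of_row (row_mx p q) = cons_tuple (p 0 0 : T) (tuple_of_row q).
Proof.
apply: (can_inj (@row_of_tupleK (1 + n))).
by rewrite row_of_cons_tuple !tuple_of_rowK -mx11_scalar.
Qed.

(** Triangular maps respect the nesting of the iterated measure. In the slice at
    first coordinate [x] the map is again affine and triangular, with a
    translation that depends on [x]; the first coordinate undergoes a
    one-dimensional affine substitution. The translation [v] is there to make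
    the induction go through. *)
Lemma tuple_lebesgue_affine n (U : 'M[R]_n) (v : 'rV[R]_n)
    (A : set (n.-tuple T)) :
    is_trig_mx U^T -> \det U != 0 -> measurable A ->
  tuple_lebesgue ((fun t => tuple_of_row (row_of_tuple t *m U + v)) @^-1` A) =
  (`|\det U|^-1%:E * tuple_lebesgue A)%E.
Proof.
elim: n U v A => [|m IHm] U v A.
  move=> _ _ _; rewrite det_mx00 normr1 invr1 mul1e; congr (tuple_lebesgue _).
  by apply/funext => t /=; congr (A _); rewrite [LHS]tuple0 [RHS]tuple0.
rewrite -[m.+1]/(1 + m)%N in U v *.
rewrite -[U]submxK -[v]hsubmxK tr_block_mx.
set a := ulsubmx U; set b := ursubmx U; set c := dlsubmx U; set D := drsubmx U.
set w := lsubmx v; set z := rsubmx v.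
rewrite is_trig_block_mx// => /and3P[/eqP c0 _ trigD].
have {}c0 : c = 0 by rewrite -[c]trmxK c0 trmx0.
rewrite c0 det_ublock det_mx11 mulf_eq0 negb_or => /andP[a0 D0] mA.
rewrite normrM invfM EFinM !tuple_lebesgueS.
have step x (t : m.-tuple T) :
    tuple_of_row (row_of_tuple (cons_tuple (x : T) t) *m block_mx a b 0 D + row_mx w z) =
    cons_tuple (x * a 0 0 + w 0 0 : T) (tuple_of_row (row_of_tuple t *m D + (x *: b + z))).
  have -> : row_of_tuple (cons_tuple (x : T) t) *m block_mx a b 0 D =
      row_mx (x%:M *m a) (x%:M *m b + row_of_tuple t *m D).
    rewrite row_of_cons_tuple -[x%:M *m a]addr0 -(mulmx0 _ (row_of_tuple t)).
    exact: (mul_row_block (x%:M : 'M[R]_1) (row_of_tuple t) a b 0 D).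
  rewrite add_row_mx row_mx_to_tuple.
  congr cons_tuple; first by rewrite mul_scalar_mx !mxE.
  by rewrite mul_scalar_mx addrCA addrA.
under eq_integral => x _.
  rewrite [X in tuple_lebesgue X](_ : _ =
      (fun t => tuple_of_row (row_of_tuple t *m D + (x *: b + z))) @^-1`
      ((fun t => cons_tuple (x * a 0 0 + w 0 0 : T) t) @^-1` A)); last first.
    by apply/funext => t; rewrite /= step.
  rewrite IHm//; last exact: measurable_cons_section.
  over.
have mtl := measurable_tuple_section mA.
rewrite ge0_integralZl//; last 2 first.
- apply: (measurableT_comp (f := fun y : T =>
      tuple_lebesgue ((fun t => cons_tuple y t) @^-1` A))
    (g := fun x : T => x * a 0 0 + w 0 0 : T)); first exact: mtl.
  exact: measurable_affine.
- by move=> x _; exact: tuple_lebesgue_ge0.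
rewrite [X in (_ * X)%E](ge0_integral_affine (w 0 0) a0 mtl).
  by rewrite muleA [(_%:E * _%:E)%E]muleC.
by move=> x; exact: tuple_lebesgue_ge0.
Qed.

End TupleLebesgue.

Section EllipsoidVolume.
Variable R : realType.
Local Notation T := (measurableTypeR R).

(** The last clause says that [U] and [N] map the unit ball to the same set.
    [U^T] is a Cholesky factor of [N^T N], so [N U^-1] is an isometry. *)
Lemma qr_factor n (N : 'M[R]_n) : \det N != 0 ->
  exists U : 'M[R]_n, [/\ is_trig_mx U^T, \det U != 0, `|\det U| = `|\det N| &
    forall y, sqnorm (y *m invmx U) = sqnorm (y *m invmx N)].
Proof.
move=> N0; have uN : N \in unitmx by rewrite unitmxE unitfE.
have uNT : N^T \in unitmx by rewrite unitmx_tr.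
have := posdef_gram uNT; rewrite trmxK => /cholesky[M [trigM _ NM]].
have detM : \det M ^+ 2 = \det N ^+ 2.
  by have := congr1 determinant NM; rewrite !det_mulmx !det_tr !expr2.
have M0 : \det M != 0 by rewrite -sqrf_eq0 detM sqrf_eq0.
have uM : M \in unitmx by rewrite unitmxE unitfE.
exists M^T; split; rewrite ?trmxK ?det_tr//.
  apply/eqP; rewrite -(@eqrXn2 _ 2)//.
  by rewrite !real_normK ?num_real// detM.
move=> y; rewrite -!qform_mulmx !trmx_inv trmxK.
have inv_mul (A B : 'M[R]_n) : A \in unitmx -> B \in unitmx ->
    invmx B *m invmx A = invmx (A *m B).
  move=> uA uB; have uAB : A *m B \in unitmx by rewrite unitmx_mul uA.
  rewrite -[LHS]mulmx1 -(mulmxV uAB) !mulmxA.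
  by rewrite -[invmx B *m invmx A *m A]mulmxA mulVmx// mulmx1 mulVmx// mul1mx.
by rewrite !inv_mul ?unitmx_tr// NM.
Qed.

Lemma measurable_sqnorm n (N : 'M[R]_n) :
  measurable_fun [set: n.-tuple T] (fun t => sqnorm (row_of_tuple t *m N) : T).
Proof.
have -> : (fun t : n.-tuple T => sqnorm (row_of_tuple t *m N) : T) =
    fun t => \sum_j (\sum_i tnth t i * N i j) ^+ 2.
  apply/funext => t; rewrite sqnormE; apply: eq_bigr => j _; rewrite mxE.
  by congr (_ ^+ 2); apply: eq_bigr => i _; rewrite mxE.
apply: measurable_sum => j; apply: measurable_funX; apply: measurable_sum => i.
by apply: measurable_funM => //; exact: measurable_tnth.
Qed.

Definition tuple_ellipsoid n (N : 'M[R]_n) : set (n.-tuple T) :=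
  [set t | sqnorm (row_of_tuple t *m N) <= 1].

Lemma measurable_tuple_ellipsoid n (N : 'M[R]_n) :
  measurable (tuple_ellipsoid N).
Proof.
have -> : tuple_ellipsoid N =
    (fun t => sqnorm (row_of_tuple t *m N) : T) @^-1` `]-oo, 1].
  by apply/seteqP; split=> t; rewrite /tuple_ellipsoid /= in_itv.
rewrite -[X in measurable X]setTI; apply: measurable_sqnorm => //.
Qed.

Definition cube n (r : R) : set (n.-tuple T) :=
  [set t | forall i, tnth t i \in `[- r, r]].

Lemma cubeS n r : @cube n.+1 r =
  (fun t : n.+1.-tuple T => (thead t, [tuple of behead t])) @^-1`
    (`[- r, r]%classic `*` @cube n r).
Proof.
have tnth_lift (t : n.+1.-tuple T) i :
    tnth t (lift ord0 i) = tnth [tuple of behead t] i.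
  by rewrite {1}[t]tuple_eta tnthS.
apply/seteqP; split=> t /=.
  by move=> ht; split=> [|i]; [exact: ht ord0|rewrite -tnth_lift; exact: ht].
move=> [h0 h] i; have [j ->|->] := unliftP ord0 i; last exact: h0.
by rewrite tnth_lift; exact: h.
Qed.

Lemma measurable_cube n r : measurable (@cube n r).
Proof.
elim: n => [|n IHn].
  by rewrite (_ : cube r = setT)//; apply/seteqP; split=> // t _ [].
rewrite cubeS -[X in measurable X]setTI; apply: measurable_uncons => //.
by apply: measurableX.
Qed.

Lemma tuple_lebesgue_cube n r : 0 < r ->
  tuple_lebesgue (@cube n r) = ((r *+ 2) ^+ n)%:E.
Proof.
move=> r0; elim: n => [|n IHn].
  rewrite (_ : cube r = setT); last by apply/seteqP; split=> // t _ [].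
  by rewrite /= diracT expr0.
have [mu muE] := tuple_lebesgue_sigma_finite R n.
rewrite /= /pushforward (_ : _ @^-1` _ = `[- r, r]%classic `*` @cube n r).
  rewrite muE product_measure1E//=; last exact: measurable_cube.
  rewrite -muE IHn lebesgue_measure_itv/= lte_fin gtrN// opprK -EFinM.
  by rewrite exprS mulr2n.
rewrite cubeS; apply/funext => -[x t] /=.
by rewrite theadE; congr (_ /\ @cube n r _); exact: val_inj.
Qed.

(** The unit ball lies between the cubes of half-widths [1 / (n + 1)] and 1. *)
Lemma tuple_ball_bounds n :
  exists2 c : R, 0 < c & tuple_lebesgue (@tuple_ellipsoid n 1%:M) = c%:E.
Proof.
have [mu muE] := tuple_lebesgue_sigma_finite R n.
have ballE t : tuple_ellipsoid 1%:M t <-> \sum_(i < n) tnth t i ^+ 2 <= 1.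
  rewrite /tuple_ellipsoid /= mulmx1 sqnormE.
  by rewrite (eq_bigr (fun i => tnth t i ^+ 2)) => [//|i _]; rewrite mxE.
have le1 : (tuple_lebesgue (@tuple_ellipsoid n 1%:M) <= ((1 *+ 2) ^+ n)%:E)%E.
  rewrite -(tuple_lebesgue_cube n (ltr01 : 0 < (1 : R))) muE.
  apply: le_measure; rewrite ?inE; [exact: measurable_tuple_ellipsoid|
    exact: measurable_cube|].
  move=> t /ballE t1 i; rewrite in_itv/= -ler_norml.
  rewrite -(@ler_pXn2r _ 2) ?nnegrE// expr1n real_normK ?num_real//.
  apply: le_trans t1; rewrite (bigD1 i)//= lerDl.
  by rewrite sumr_ge0// => j _; rewrite sqr_ge0.
pose r : R := n.+1%:R^-1.
have r0 : 0 < r by rewrite invr_gt0.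
have ge : (((r *+ 2) ^+ n)%:E <= tuple_lebesgue (@tuple_ellipsoid n 1%:M))%E.
  rewrite -(tuple_lebesgue_cube n r0) muE.
  apply: le_measure; rewrite ?inE; [exact: measurable_cube|
    exact: measurable_tuple_ellipsoid|].
  move=> t tr; apply/ballE; apply: (@le_trans _ _ (\sum_(i < n) r)).
    apply: ler_sum => i _; have := tr i; rewrite in_itv/= -ler_norml => tir.
    have r1 : r <= 1 by rewrite invf_le1// ler1n.
    rewrite -real_normK ?num_real// expr2.
    apply: le_trans (ler_pM _ _ tir tir) _ => //.
    by rewrite ger_pMr.
  rewrite sumr_const card_ord -mulr_natl ler_pdivrMr// mul1r ler_nat.
  exact: leqnSn.
have fin : tuple_lebesgue (@tuple_ellipsoid n 1%:M) \is a fin_num.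
  by rewrite ge0_fin_numE ?tuple_lebesgue_ge0// (le_lt_trans le1)// ltry.
exists (fine (tuple_lebesgue (@tuple_ellipsoid n 1%:M))); last by rewrite fineK.
rewrite -lte_fin fineK//; apply: lt_le_trans ge.
by rewrite lte_fin exprn_gt0// mulrn_wgt0.
Qed.

Lemma image_unit_ball (E : euclideanType R) (S : 'End(E)) : hom_det S != 0 ->
  S @` @unit_ball R E = [set x | `|hom_inv S x| <= 1].
Proof.
move=> S0; apply/seteqP; split=> [_ [x x1 <-]|x x1] /=; first by rewrite hom_invK.
by exists (hom_inv S x); rewrite ?hom_invKV.
Qed.

Lemma volume_ellipsoid (E : euclideanType R) : exists2 c : R, 0 < c &
  forall S : 'End(E), hom_det S != 0 ->
    volume (S @` @unit_ball R E) = (`|hom_det S| * c)%:E.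
Proof.
have [c c0 cE] := tuple_ball_bounds (dim E); exists c => // S S0.
have [U [trigU U0 detU normU]] := qr_factor S0.
have uU : U \in unitmx by rewrite unitmxE unitfE.
have coordsE (x : E) : coords x = tuple_of_row (crd x).
  by apply: eq_from_tnth => i; rewrite !tnth_mktuple mxE.
have -> : volume (S @` @unit_ball R E) =
    tuple_lebesgue (tuple_ellipsoid (invmx U)).
  rewrite /volume image_unit_ball//; congr (tuple_lebesgue _).
  apply/seteqP; split=> [_ [x + <-]|t] /=; rewrite /tuple_ellipsoid /= normU.
    by rewrite coordsE tuple_of_rowK norm_le1 crd_hom_of_mx.
  move=> t1; exists (vec (row_of_tuple t)); last by rewrite coordsE vecK row_of_tupleK.
  by rewrite /= norm_le1 crd_hom_of_mx vecK.
have := tuple_lebesgue_affine 0 trigU U0 (measurable_tuple_ellipsoid (invmx U)).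
have -> : (fun t => tuple_of_row (row_of_tuple t *m U + 0)) @^-1`
    tuple_ellipsoid (invmx U) = tuple_ellipsoid 1%:M.
  apply/funext => t; rewrite /tuple_ellipsoid /= tuple_of_rowK addr0.
  by rewrite -mulmxA mulmxV.
rewrite cE EFinM => ->; rewrite muleA -EFinM -detU divff ?normr_eq0//.
by rewrite mul1e.
Qed.

End EllipsoidVolume.

(** * Symmetric convex bodies and polarity *)

Section ConvexGeometry.
Variables (R : realType) (E : euclideanType R).
Implicit Types (P C : set E) (x y z : E).

Lemma innerNr x y : inner x (- y) = - inner x y.
Proof. by rewrite -scaleN1r innerZr mulN1r. Qed.

Lemma innerBr x y z : inner x (y - z) = inner x y - inner x z.
Proof. by rewrite innerDr innerNr. Qed.

Lemma innerBl x y z : inner (x - y) z = inner x z - inner y z.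
Proof. by rewrite ![inner _ z]innerC innerBr. Qed.

Lemma inner_le_norm x y : inner x y <= `|x| * `|y|.
Proof.
have normE z : dot_norm edot z = `|z|.
  by rewrite /dot_norm edot_norm sqrtr_sqr normr_id.
by rewrite -!normE; exact: dot_cauchy_schwarz.
Qed.

Lemma inner_subZ x y (a : R) : inner (x - a *: y) (x - a *: y) =
  inner x x - 2 * (a * inner y x) + a * (a * `|y| ^+ 2).
Proof.
rewrite innerBl !innerBr !innerZl !innerZr (innerC x y) (inner_norm y); ring.
Qed.

Lemma convex_comb P x y (t : R) : convex_set P -> P x -> P y ->
  0 <= t -> t <= 1 -> P (t *: x + (1 - t) *: y).
Proof.
move=> cP Px Py t0 t1.
by have := cP x y (Itv01 t0 t1) (mem_set Px) (mem_set Py); rewrite inE.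
Qed.

Lemma symmetric_bodyN P x : symmetric_body P -> P x -> P (- x).
Proof. by move=> [_ PN] Px; rewrite PN; exists x. Qed.

(** A ball around an interior point [p] can be moved to the origin: [x] is the
    midpoint of [p + x] and of [- (p - x)], which both lie in [P]. *)
Lemma body_bounds P : symmetric_body P -> exists r r' : R,
  [/\ 0 < r, 0 < r', forall x, `|x| <= r -> P x & forall x, P x -> `|x| <= r'].
Proof.
move=> sP; have [[cP convP [p pP]] _] := sP.
have /nbhs_ballP[e /= e0 pe] : nbhs p P by exact: pP.
have [M [_ Mb]] := compact_bounded cP.
exists (e / 2), (`|M| + 1); split=> //; first by rewrite divr_gt0.
- move=> x xe; have ball_p z : `|z| <= e / 2 -> P (p + z).
    move=> ze; apply: pe; rewrite -ball_normE /= opprD addNKr normrN.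
    by apply: le_lt_trans ze _; lra.
  have := convex_comb convP (ball_p x xe)
    (symmetric_bodyN sP (ball_p (- x) _)) (t := 2^-1).
  rewrite normrN => /(_ xe); rewrite opprD opprK.
  have -> : 2^-1 *: (p + x) + (1 - 2^-1) *: (- p + x) = x.
    have -> : 1 - 2^-1 = 2^-1 :> R by field.
    rewrite -scalerDr addrACA subrr add0r scalerDr -scalerDl.
    by rewrite (_ : 2^-1 + 2^-1 = 1 :> R) ?scale1r//; field.
  by apply; lra.
- by move=> x Px; apply: Mb Px; rewrite (le_lt_trans (ler_norm _))// ltrDl.
Qed.

Lemma polarP C y : polar C y <-> forall x, C x -> inner x y <= 1.
Proof.
split=> [/ereal_supP h x Cx|h].
  by rewrite -lee_fin; apply: h; exists x.
by apply/ereal_supP => _ [x Cx <-]; rewrite lee_fin h.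
Qed.

Lemma polar_bounds C (r r' : R) : 0 < r -> 0 < r' ->
    (forall x, `|x| <= r -> C x) -> (forall x, C x -> `|x| <= r') ->
  (forall y, `|y| <= r'^-1 -> polar C y) /\
  (forall y, polar C y -> `|y| <= r^-1).
Proof.
move=> r0 r'0 rC Cr'; split=> y.
  move=> yr; apply/polarP => x /Cr' xr; apply: le_trans (inner_le_norm _ _) _.
  by rewrite -(divff (lt0r_neq0 r'0)) ler_pM.
move=> /polarP yC; have [->|y0] := eqVneq y 0.
  by rewrite normr0 invr_ge0 ltW.
have ny0 : 0 < `|y| by rewrite normr_gt0.
have := yC ((r / `|y|) *: y); rewrite innerZl inner_norm => h.
rewrite -(ler_pM2l r0) divff ?lt0r_neq0//.
suff <- : r / `|y| * `|y| ^+ 2 = r * `|y|.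
  apply/h/rC; rewrite normrZ ger0_norm ?divr_ge0 ?(ltW r0)//.
  by rewrite divfK// lt0r_neq0.
by field; rewrite lt0r_neq0.
Qed.

Lemma dist_continuous x : continuous (fun q : E => `|x - q|).
Proof.
move=> q; apply: cvg_norm; apply: cvgB; [exact: cvg_cst|exact: cvg_id].
Qed.

(** The point [p] of [P] nearest to [x] sees all of [P] on the other side of the
    hyperplane through [p] orthogonal to [x - p]: if a point [q] made an acute
    angle, moving from [p] slightly towards [q] would come closer to [x]. *)
Lemma nearest_point P x : compact P -> convex_set P -> P !=set0 ->
  exists2 p, P p & forall q, P q -> inner (q - p) (x - p) <= 0.
Proof.
move=> cP convP P0.
have [p] := compact_EVT_min P0 cP (continuous_subspaceT (@dist_continuous x)).
rewrite inE => Pp pmin; exists p => // q Pq.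
rewrite leNgt; apply/negP; set d := q - p; set y := x - p => dy.
pose s := `|d| ^+ 2.
have s0 : 0 <= s by rewrite sqr_ge0.
(* A step in ]0, 1] with t s < <d, y>, so that t^2 s - 2 t <d, y> < 0; it avoids
   a case distinction on s = 0. *)
pose t := inner d y / (inner d y + s).
have ds0 : 0 < inner d y + s by rewrite ltr_wpDr.
have t0 : 0 < t by rewrite divr_gt0.
have t1 : t <= 1 by rewrite ler_pdivrMr// mul1r lerDl.
have := pmin _ (mem_set (convex_comb convP Pq Pp (ltW t0) t1)).
have -> : x - (t *: q + (1 - t) *: p) = y - t *: d.
  by rewrite /y /d scalerBl scale1r scalerBr addrCA opprD addrA.
rewrite -/y -(@ler_pXn2r _ 2) ?nnegrE// -!inner_norm.
rewrite inner_subZ -/s => h.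
have : t * s < inner d y.
  by rewrite /t mulrAC ltr_pdivrMr// ltr_pM2l// ltrDr.
rewrite -(ltr_pM2l t0) => ts; have := mulr_gt0 t0 dy; lra.
Qed.

(** Otherwise the hyperplane at the nearest point [p] separates [x] from [P]. *)
Lemma bipolar P x : symmetric_body P ->
  (forall y, polar P y -> inner x y <= 1) -> P x.
Proof.
move=> sP h; have [[cP convP _] _] := sP.
have [r [r' [r0 _ rP _]]] := body_bounds sP.
have P0 : P 0 by apply: rP; rewrite normr0 ltW.
have [p Pp pP] := nearest_point x cP convP (ex_intro _ _ P0).
have [->//|xp] := eqVneq x p.
pose y := x - p; have y0 : 0 < `|y| ^+ 2.
  by rewrite exprn_gt0// normr_gt0 subr_eq0.
have m0 : 0 <= inner p y.
  by have := pP _ P0; rewrite innerBl inner0l sub0r oppr_le0.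
(* The level s lies strictly between <p, y> and <x, y>, and it is positive, so
   y / s belongs to the polar but has inner product above 1 with x. *)
pose s := inner p y + `|y| ^+ 2 / 2.
have s0 : 0 < s by rewrite /s; lra.
have : polar P (s^-1 *: y).
  apply/polarP => q Pq; rewrite innerZr mulrC ler_pdivrMr// mul1r.
  by have := pP _ Pq; rewrite innerBl /s -/y; lra.
move=> /h; rewrite innerZr mulrC ler_pdivrMr// mul1r.
have -> : inner x y = inner p y + `|y| ^+ 2.
  by rewrite -inner_norm /y innerBl; ring.
by rewrite /s; lra.
Qed.

Lemma hom_bounded (F : euclideanType R) (S : 'Hom(E, F)) :
  exists2 c : R, 0 < c & forall x, `|S x| <= c * `|x|.
Proof.
have [c c0 cS] := qform_bound (mx_of_hom S *m (mx_of_hom S)^T).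
exists (Num.sqrt (c + 1)); first by rewrite sqrtr_gt0; lra.
move=> x; rewrite -(@ler_pXn2r _ 2) ?nnegrE ?mulr_ge0 ?sqrtr_ge0//.
rewrite exprMn sqr_sqrtr; last by lra.
rewrite -!sqnorm_crd crd_lfun -qform_mulmx.
apply: le_trans (ler_norm _) _; apply: le_trans (cS _) _.
by rewrite ler_wpM2r ?sqnorm_ge0// lerDl.
Qed.

Lemma vec_continuous (S : 'End(E)) : continuous (fun u => S (vec u : E)).
Proof.
have -> : (fun u => S (vec u : E)) =
    fun u : 'rV[R]_(dim E) => \sum_i u 0 i *: S (onb i).
  apply/funext => u; rewrite /vec linear_sum; apply: eq_bigr => i _.
  by rewrite linearZ.
apply: continuous_big; first exact: add_continuous.
move=> i _ u; apply: (@cvgZr_tmp _ _ _ (nbhs u) _ (fun v : 'rV[R]__ => v 0 i)).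
exact: coord_continuous.
Qed.

(** Compactness comes from the coordinate space, of which an ellipsoid is a
    continuous image; boundedness of the inverse map gives a ball inside. *)
Lemma ellipsoid_body (L : set E) : ellipsoid L -> symmetric_body L.
Proof.
move=> [S [/hom_det_neq0 S0 ->]]; split; last first.
  apply/seteqP; split=> [_ [x x1 <-]|_ [_ [x x1 <-] <-]].
    exists (S (- x)); last by rewrite linearN opprK.
    by exists (- x); rewrite // /unit_ball /= normrN.
  by exists (- x); [rewrite /unit_ball /= normrN|rewrite linearN].
split.
- pose B : set 'rV[R]_(dim E) := [set u | sqnorm u <= 1].
  have -> : S @` @unit_ball R E = (fun u => S (vec u)) @` B.
    apply/seteqP; split=> [_ [x x1 <-]|_ [u u1 <-]].
      by exists (crd x); [rewrite /B /= -norm_le1|rewrite crdK].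
    by exists (vec u); rewrite // /unit_ball /= norm_le1 vecK.
  apply: continuous_compact.
    by apply: continuous_subspaceT; exact: vec_continuous.
  apply: bounded_closed_compact.
    exists 1; split; first exact: num_real.
    move=> c c1 u u1 /=; rewrite [leLHS]/Num.norm/= mx_normrE.
    apply: bigmax_le => [|[i0 k] _]; first by rewrite (le_trans _ (ltW c1)).
    rewrite ord1 /=; apply: le_trans (ltW c1).
    rewrite -(@ler_pXn2r _ 2) ?nnegrE// expr1n real_normK ?num_real//.
    apply: le_trans u1; rewrite sqnormE (bigD1 k)//= lerDl.
    by rewrite sumr_ge0// => j _; rewrite sqr_ge0.
  apply: (@closed_comp _ _ (@sqnorm R (dim E)) [set x | x <= 1]).
    have -> : @sqnorm R (dim E) = fun u => \sum_i u 0 i * u 0 i.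
      apply/funext => u; rewrite sqnormE.
      by apply: eq_bigr => i _; rewrite expr2.
    move=> u _; apply: continuous_sum => i.
    by apply: continuous_mul; exact: coord_continuous.
  exact: closed_le.
- move=> _ _ t /set_mem[x x1 <-] /set_mem[y y1 <-]; apply/mem_set.
  exists (t%:num *: x + (1 - t%:num) *: y); last first.
    by rewrite linearD !linearZ.
  rewrite /unit_ball /=; apply: le_trans (ler_normD _ _) _.
  have t0 : 0 <= t%:num by [].
  have t1 : 0 <= 1 - t%:num by rewrite subr_ge0.
  rewrite !normrZ !ger0_norm//.
  have := ler_wpM2l t0 x1; have := ler_wpM2l t1 y1; rewrite !mulr1; lra.
- have [c c0 cS] := hom_bounded (hom_inv S).
  exists 0; apply/nbhs_ballP; exists c^-1 => /=; first by rewrite invr_gt0.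
  move=> x; rewrite -ball_normE /= sub0r normrN => xc.
  exists (hom_inv S x); rewrite ?hom_invKV// /unit_ball /=; apply: le_trans (cS x) _.
  by rewrite -(divff (lt0r_neq0 c0)) ler_pM2l// ltW.
Qed.

End ConvexGeometry.

(** * Extremal ellipsoids as maximisers of a determinant *)

Section ExtremalEllipsoids.
Variables (R : realType) (E : euclideanType R).
Implicit Types (P C L : set E) (S T : 'End(E)).
Local Notation B := (@unit_ball R E).

Lemma hom_inv_hom_inv T : hom_inv (hom_inv T) = T.
Proof. by apply: mx_of_hom_inj; rewrite !hom_of_mxK invmxK. Qed.

Lemma sub_ellipsoid C T : hom_det T != 0 ->
  C `<=` T @` B <-> forall x, C x -> `|hom_inv T x| <= 1.
Proof. by move=> T0; rewrite image_unit_ball. Qed.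

Lemma norm_adjoint_le1 T y :
  `|adjoint T y| <= 1 <-> forall b, `|b| <= 1 -> inner (T b) y <= 1.
Proof.
split=> [y1 b b1|h].
  rewrite inner_adjoint; apply: le_trans (inner_le_norm _ _) _.
  by rewrite mulr_ile1.
have [->|z0] := eqVneq (adjoint T y) 0; first by rewrite normr0.
have nz : `|adjoint T y| != 0 by rewrite normr_eq0.
have := h (`|adjoint T y|^-1 *: adjoint T y).
rewrite inner_adjoint innerZl inner_norm expr2 mulKf//; apply.
by rewrite normrZ normfV normr_id mulVf.
Qed.

(** Polarity turns the inclusion [T B] in [P] into a constraint on [T^*] of the
    kind that defines an ellipsoid around the polar of [P]. *)
Lemma ellipsoid_sub P T : symmetric_body P ->
  T @` B `<=` P <-> forall y, polar P y -> `|adjoint T y| <= 1.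
Proof.
move=> sP; split=> [TP y /polarP yP|h _ [b b1 <-]].
  by apply/norm_adjoint_le1 => b b1; apply: yP; apply: TP; exists b.
by apply: bipolar => // y /h/norm_adjoint_le1; apply.
Qed.

(** The support function of [T B] is [|T^* z|], so ellipsoids whose adjoint maps
    have the same norms are equal. *)
Lemma ellipsoid_support T x : hom_det T != 0 ->
  (T @` B) x <-> forall z, inner x z <= `|adjoint T z|.
Proof.
move=> T0; rewrite image_unit_ball//; split=> [/= x1 z|h /=].
  rewrite -[x in inner x _](hom_invKV T0) inner_adjoint.
  apply: le_trans (inner_le_norm _ _) _.
  by rewrite -[leRHS]mul1r ler_wpM2r.
set b := hom_inv T x; have A0 : hom_det (adjoint T) != 0 by rewrite hom_det_adjoint.
have := h (hom_inv (adjoint T) b); rewrite -{1}[x](hom_invKV T0) inner_adjoint.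
rewrite hom_invKV// -/b inner_norm => bb.
have [->|b0] := eqVneq b 0; first by rewrite normr0.
by rewrite -(ler_pM2l (_ : 0 < `|b|)) ?mulr1 ?normr_gt0// -expr2.
Qed.

Lemma ellipsoidE L : ellipsoid L <-> exists2 T, hom_det T != 0 & L = T @` B.
Proof.
by split=> [[T [/hom_det_neq0 T0 ->]]|[T /hom_det_neq0 T0 ->]]; exists T.
Qed.

Lemma volume_le S T : hom_det S != 0 -> hom_det T != 0 ->
  (volume (S @` B) <= volume (T @` B))%E = (`|hom_det S| <= `|hom_det T|).
Proof.
move=> S0 T0; have [c c0 vol] := volume_ellipsoid E.
by rewrite !vol// lee_fin ler_pM2r.
Qed.

Lemma lowner_optimal P T : hom_det T != 0 ->
  is_lowner P (T @` B) <-> optimal P (hom_inv T).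
Proof.
move=> T0; split=> [[_ PT minT]|[_ fT maxT]].
  split; first by rewrite hom_det_hom_inv invr_neq0.
    exact/sub_ellipsoid.
  move=> S' fS'; have [->|S'0] := eqVneq (hom_det S') 0; first by rewrite normr0.
  have S'i0 : hom_det (hom_inv S') != 0 by rewrite hom_det_hom_inv invr_neq0.
  have : (volume (T @` B) <= volume (hom_inv S' @` B))%E.
    apply: minT; first by apply/ellipsoidE; exists (hom_inv S').
    by apply/sub_ellipsoid => // x Px; rewrite hom_inv_hom_inv fS'.
  rewrite volume_le//.
  rewrite !hom_det_hom_inv !normfV => h.
  by rewrite -[leLHS]invrK lef_pV2 ?posrE ?invr_gt0 ?normr_gt0.
split; first by apply/ellipsoidE; exists T.
  exact/sub_ellipsoid.
move=> _ /ellipsoidE[T' T'0 ->] /sub_ellipsoid-/(_ T'0)/maxT.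
rewrite volume_le// !hom_det_hom_inv !normfV lef_pV2 ?posrE ?normr_gt0//.
Qed.

Lemma john_optimal_polar P T : symmetric_body P -> hom_det T != 0 ->
  is_john P (T @` B) <-> optimal (polar P) (adjoint T).
Proof.
move=> sP T0; split=> [[_ TP maxT]|[_ fT maxT]].
  split; first by rewrite hom_det_adjoint.
    exact/ellipsoid_sub.
  move=> S' fS'; have [->|S'0] := eqVneq (hom_det S') 0; first by rewrite normr0.
  have S'a0 : hom_det (adjoint S') != 0 by rewrite hom_det_adjoint.
  rewrite (hom_det_adjoint T) -(hom_det_adjoint S') -volume_le//; apply: maxT.
    by apply/ellipsoidE; exists (adjoint S').
  by apply/ellipsoid_sub => // y Py; rewrite adjointK fS'.
split; first by apply/ellipsoidE; exists T.
  exact/ellipsoid_sub.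
move=> _ /ellipsoidE[T' T'0 ->] /(ellipsoid_sub _ sP)/maxT.
by rewrite volume_le// !hom_det_adjoint.
Qed.

Lemma Lowner_spec P : symmetric_body P -> is_lowner P (Lowner P).
Proof.
move=> sP; apply: xgetPex.
have [r [r' [r0 r'0 rP Pr']]] := body_bounds sP.
have [S optS] := optimal_exists r0 r'0 rP Pr'.
have S0 : hom_det S != 0 by case: optS.
exists (hom_inv S @` B); apply/lowner_optimal.
  by rewrite hom_det_hom_inv invr_neq0.
by rewrite hom_inv_hom_inv.
Qed.

Lemma John_spec P : symmetric_body P -> is_john P (John P).
Proof.
move=> sP; apply: xgetPex.
have [r [r' [r0 r'0 rP Pr']]] := body_bounds sP.
have [r'P Pr] := polar_bounds r0 r'0 rP Pr'.
have ri0 : 0 < r^-1 by rewrite invr_gt0.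
have r'i0 : 0 < r'^-1 by rewrite invr_gt0.
have [S optS] := optimal_exists r'i0 ri0 r'P Pr.
have S0 : hom_det S != 0 by case: optS.
exists (adjoint S @` B); apply/john_optimal_polar => //.
  by rewrite hom_det_adjoint.
by rewrite adjointK.
Qed.

(** [T^-1] maps the ellipsoid to the unit ball, which is in John position because
    it contains an orthonormal basis. *)
Lemma ellipsoid_optimal T : hom_det T != 0 -> optimal (T @` B) (hom_inv T).
Proof.
move=> T0; have Ti0 : hom_det (hom_inv T) != 0 by rewrite hom_det_hom_inv invr_neq0.
split=> //; first exact/sub_ellipsoid.
move=> S' fS'; apply: (proj1 (john_optimal Ti0 _ fS')) => g _ g1.
have -> : (dim E)%:R = \sum_(i < dim E) (1 : R) by rewrite sumr_const card_ord.
apply: ler_sum => i _; apply: g1.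
exists (T (onb i)); last by rewrite hom_invK.
exists (onb i) => //; rewrite /unit_ball /= -(@ler_pXn2r _ 2) ?nnegrE//.
by rewrite -inner_norm onbP eqxx expr1n.
Qed.

End ExtremalEllipsoids.

Section TensorEllipsoids.
Variables (R : realType) (l : nat) (E : 'I_l -> euclideanType R).

Lemma norm_otimes (x : forall i, E i) : `|otimes x| = \prod_i `|x i|.
Proof.
apply/eqP; rewrite -(@eqrXn2 _ 2)//; last by rewrite prodr_ge0.
rewrite -inner_norm inner_otimes -prodrXl; apply/eqP.
by apply: eq_bigr => i _; rewrite inner_norm.
Qed.

Lemma norm_tensor_map_otimes (S : forall i, 'End(E i)) (x : forall i, E i) :
  (forall i, `|S i (x i)| <= 1) -> `|tensor_map S (otimes x)| <= 1.
Proof.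
move=> Sx; rewrite tensor_map_otimes norm_otimes.
by apply: prodr_ile1 => i _; rewrite normr_ge0 Sx.
Qed.

Lemma tensor_map_hom_inv (T : forall i, 'End(E i)) : (forall i, hom_det (T i) != 0) ->
  hom_det (tensor_map T) != 0 /\
  hom_inv (tensor_map T) = tensor_map (fun i => hom_inv (T i)).
Proof.
move=> T0.
have TK : cancel (tensor_map T) (tensor_map (fun i => hom_inv (T i))).
  by apply: tensor_mapK => i; exact: hom_invK.
have TT0 : hom_det (tensor_map T) != 0.
  apply/hom_det_neq0; exists (tensor_map (fun i => hom_inv (T i))) => //.
  by apply: tensor_mapK => i; exact: hom_invKV.
split=> //; apply/lfunP => z.
by rewrite -{1}[z](hom_invKV TT0) hom_invK// -{2}[z](hom_invKV TT0) TK.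
Qed.

(** Two families of maps with the same images of the unit balls have inverses
    that are optimal for the same ellipsoids; their tensor products are then both
    optimal for the elementary tensors, and the uniqueness in [tensor_optimal]
    shows that they have the same image of the unit ball. *)
Lemma hilbert_tensorE (T : forall i, 'End(E i)) : (forall i, hom_det (T i) != 0) ->
  hilbert_tensor (fun i => T i @` @unit_ball R (E i)) =
  tensor_map T @` @unit_ball R (tensor E).
Proof.
move=> T0; apply/seteqP; split=> [z [T' [T'P]]|z Tz]; last first.
  by exists T; split=> // i; split=> //; exact/hom_det_neq0.
have T'0 i : hom_det (T' i) != 0 by apply/hom_det_neq0; case: (T'P i).
have [TT0 TTi] := tensor_map_hom_inv T0.
have [TT'0 TT'i] := tensor_map_hom_inv T'0.
have optT i := ellipsoid_optimal (T0 i).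
have optT' i : optimal (T i @` @unit_ball R (E i)) (hom_inv (T' i)).
  by case: (T'P i) => _ ->; exact: ellipsoid_optimal.
have fits (S : forall i, 'End(E i)) :
    (forall i, optimal (T i @` @unit_ball R (E i)) (S i)) ->
  forall x, (forall i, (T i @` @unit_ball R (E i)) (x i)) ->
    `|tensor_map S (otimes x)| <= 1.
  move=> optS x Cx; apply: norm_tensor_map_otimes => i.
  by case: (optS i) => _ + _; apply; exact: Cx.
have [_ maxT] := tensor_optimal optT.
have [_ maxT'] := tensor_optimal optT'.
have [le1 eq1] := maxT _ (fits _ optT').
have [le2 _] := maxT' _ (fits _ optT).
have normE := eq1 (le_anti (introT andP (conj le1 le2))).
rewrite (image_unit_ball TT'0) (image_unit_ball TT0) /mkset TTi TT'i normE.
exact: id.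
Qed.

Lemma proj_tensor_otimes (P : forall i, set (E i)) (x : forall i, E i) :
  (forall i, P i (x i)) -> proj_tensor P (otimes x).
Proof. by move=> Px; apply: sub_gen_smallest; exists x. Qed.

End TensorEllipsoids.

(** * Extremal ellipsoids of tensor products *)

Section TensorExtremal.
Variables (R : realType) (l : nat) (alpha : tensor_operation R l).
Hypothesis halpha : is_tensor_product alpha.
Lemma tensor_product_mono (E : 'I_l -> euclideanType R)
    (P Q : forall i, set (E i)) :
    (forall i, symmetric_body (P i)) -> (forall i, symmetric_body (Q i)) ->
    (forall i, P i `<=` Q i) ->
  alpha P `<=` alpha Q.
Proof.
move=> hP hQ PQ z Pz; apply: (tensor_product_map halpha hP hQ (T := fun=> \1%VF)).
  by move=> i _ [x Px <-]; rewrite id_lfunE; exact: PQ.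
by exists z => //; rewrite tensor_map_id.
Qed.

Variables (E : 'I_l -> euclideanType R) (P : forall i, set (E i)).
Arguments P : clear implicits.
Hypothesis hP : forall i, symmetric_body (P i).

(** With [T_i B] the Loewner ellipsoid of [P_i], the inverse of the tensor
    product of the [T_i] is at most 1 on the product of the [P_i] by the
    assumption on ellipsoids. It beats every competitor because the product
    contains the elementary tensors, and the Loewner ellipsoid of the product
    attains the same determinant. *)
Lemma Lowner_tensor : sub_hilbert_on_ellipsoids alpha ->
  Lowner (alpha P) = hilbert_tensor (fun i => Lowner (P i)).
Proof.
move=> alpha2.
have LP i := Lowner_spec (hP i).
have LE i : {T : 'End(E i) | hom_det T != 0 & Lowner (P i) = T @` @unit_ball R (E i)}.
  by apply: cid2; apply/ellipsoidE; case: (LP i).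
pose T i := s2val (LE i).
have T0 i : hom_det (T i) != 0 := s2valP (LE i).
have TL i : Lowner (P i) = T i @` @unit_ball R (E i) := s2valP' (LE i).
have -> : hilbert_tensor (fun i => Lowner (P i)) =
    tensor_map T @` @unit_ball R (tensor E).
  rewrite -hilbert_tensorE//; congr hilbert_tensor.
  exact/functional_extensionality_dep.
have [TT0 TTi] := tensor_map_hom_inv T0.
have optT i : optimal (P i) (hom_inv (T i)).
  by apply/lowner_optimal; rewrite -?TL.
have [TTi0 maxT] := tensor_optimal optT.
have fit (S : 'End(tensor E)) : (forall z, alpha P z -> `|S z| <= 1) ->
    forall x, (forall i, P i (x i)) -> `|S (otimes x)| <= 1 :> R.
  move=> fS x Px; apply/fS/(tensor_product_proj halpha hP).
  exact: proj_tensor_otimes.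
have optTT : optimal (alpha P) (hom_inv (tensor_map T)).
  rewrite TTi; split=> // [|S' fS'].
    move=> z Pz; rewrite -TTi; move: z Pz; apply/sub_ellipsoid => //.
    rewrite -hilbert_tensorE//; apply: subset_trans (alpha2 _ _ _).
      by apply: tensor_product_mono => // i; rewrite -?TL;
        [apply: ellipsoid_body|]; case: (LP i).
    by move=> i; rewrite -TL; case: (LP i).
  by have [] := maxT S' (fit _ fS').
have isL := Lowner_spec (tensor_product_body halpha hP).
have [/ellipsoidE[T' T'0 L'E] _ _] := isL.
move: isL; rewrite L'E => /(lowner_optimal _ T'0)[_ fT' maxT'].
have [_ fTT maxTT] := optTT.
have [le1 eq1] := maxT _ (fit _ fT').
have le2 := maxT' _ fTT; rewrite TTi in le2.
have normE := eq1 (le_anti (introT andP (conj le1 le2))).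
rewrite (image_unit_ball T'0) (image_unit_ball TT0) TTi.
by apply/funext => z; rewrite /mkset normE.
Qed.

(** Same argument on the polar side. An ellipsoid inside the product of the [P_i]
    lies in their injective product, hence its adjoint map is at most 1 on the
    elementary tensors of the polars, where the adjoints of the maps that define
    the John ellipsoids of the [P_i] are optimal. *)
Lemma John_tensor : hilbert_sub_on_ellipsoids alpha ->
  John (alpha P) = hilbert_tensor (fun i => John (P i)).
Proof.
move=> alpha2.
have JP i := John_spec (hP i).
have JE i : {T : 'End(E i) | hom_det T != 0 & John (P i) = T @` @unit_ball R (E i)}.
  by apply: cid2; apply/ellipsoidE; case: (JP i).
pose T i := s2val (JE i).
have T0 i : hom_det (T i) != 0 := s2valP (JE i).
have TJ i : John (P i) = T i @` @unit_ball R (E i) := s2valP' (JE i).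
have hJ : (fun i => John (P i)) = (fun i => T i @` @unit_ball R (E i)).
  exact/functional_extensionality_dep.
have [TT0 _] := tensor_map_hom_inv T0.
have optT i : optimal (polar (P i)) (adjoint (T i)).
  by apply/john_optimal_polar; rewrite -?TJ.
have [_ maxT] := tensor_optimal optT.
rewrite -adjoint_tensor_map in maxT.
have sA := tensor_product_body halpha hP.
have fit (S : 'End(tensor E)) : (forall z, polar (alpha P) z -> `|S z| <= 1) ->
    forall y, (forall i, polar (P i) (y i)) -> `|S (otimes y)| <= 1 :> R.
  move=> fS y Py; apply: fS; apply/polarP => z /(tensor_product_inj halpha hP).
  move=> /polarP; rewrite innerC; apply; exact: proj_tensor_otimes.
have fTT : forall z, polar (alpha P) z -> `|adjoint (tensor_map T) z| <= 1.
  apply/ellipsoid_sub => //; rewrite -hilbert_tensorE// -hJ.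
  apply: (@subset_trans _ (alpha (fun i => John (P i)))).
    by apply: alpha2 => i; case: (JP i).
  by apply: tensor_product_mono => // i; [apply: ellipsoid_body|]; case: (JP i).
have [/ellipsoidE[T' T'0 J'E] _ _] := John_spec sA.
have := John_spec sA; rewrite J'E => /(john_optimal_polar sA T'0)[_ fT' maxT'].
have [le1 eq1] := maxT _ (fit _ fT').
have le2 := maxT' _ fTT.
have normE := eq1 (le_anti (introT andP (conj le1 le2))).
rewrite hJ hilbert_tensorE//; apply/funext => z; apply/propext.
have [toT' ofT'] := ellipsoid_support z T'0.
have [toT ofT] := ellipsoid_support z TT0.
by split=> [/toT' h|/toT h]; [apply: ofT|apply: ofT'] => w;
  [rewrite -normE|rewrite normE].
Qed.

End TensorExtremal.

Theorem proposition3p14 (R : realType) (l : nat) (l_gt0 : (0 < l)%N)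
    (alpha : tensor_operation R l) (halpha : is_tensor_product alpha)
    (E : 'I_l -> euclideanType R) (P : forall i, set (E i))
    (hP : forall i, symmetric_body (P i)) :
  (sub_hilbert_on_ellipsoids alpha ->
     Lowner (alpha E P) = hilbert_tensor (fun i => Lowner (P i))) /\
  (hilbert_sub_on_ellipsoids alpha ->
     John (alpha E P) = hilbert_tensor (fun i => John (P i))).
Proof. by split; [exact: Lowner_tensor|exact: John_tensor]. Qed.
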